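(* Let $\mathcal{A}$ be a (nonzero) unital $C^*$-algebra, $\mathcal{H}$ a complex Hilbert space and $P\in\mathscr{B}(\mathcal{H})$ a positive operator. Then the set of $P$-$C^*$-extreme points of $\mathrm{CP}^{(P)}(\mathcal{A},\mathscr{B}(\mathcal{H}))$ and the set of linear extreme points of $\mathrm{CP}^{(P)}(\mathcal{A},\mathscr{B}(\mathcal{H}))$ are both non-empty. In fact, the following hold: (i) If $\psi$ is a pure state on $\mathcal{A}$ and $\Phi(a):=\psi(a)P$ for $a\in\mathcal{A}$, then $\Phi$ is both a $P$-$C^*$-extreme point and a linear extreme point of $\mathrm{CP}^{(P)}(\mathcal{A},\mathscr{B}(\mathcal{H}))$. (ii) If $\Phi:\mathcal{A}\to\mathscr{B}(\mathcal{H})$ is any pure CP map with $\Phi(1)=P$, then $\Phi$ is both a $P$-$C^*$-extreme point and a linear extreme point of $\mathrm{CP}^{(P)}(\mathcal{A},\mathscr{B}(\mathcal{H}))$.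
   Context: $\mathscr{B}(\mathcal{H})$ is the algebra of bounded linear operators on $\mathcal{H}$; $1$ is the unit of $\mathcal{A}$. ''CP'' means completely positive (linear). For $T\in\mathscr{B}(\mathcal{H})$, $\mathrm{Ad}_T(X):=T^*XT$ for $X\in\mathscr{B}(\mathcal{H})$. For CP maps $\Psi,\Phi$, $\Psi\leq_{cp}\Phi$ means that $\Phi-\Psi$ is CP. A CP map $\Phi$ is pure if the only CP maps $\Psi\leq_{cp}\Phi$ are those of the form $t\Phi$ with $t\in[0,1]$. For a positive operator $P$, $\mathrm{CP}^{(P)}(\mathcal{A},\mathscr{B}(\mathcal{H}))$ is the set of all CP maps $\Phi:\mathcal{A}\to\mathscr{B}(\mathcal{H})$ with $\Phi(1)=P$ (a convex set). A map $\Phi\in\mathrm{CP}^{(P)}(\mathcal{A},\mathscr{B}(\mathcal{H}))$ is a $P$-$C^*$-extreme point of this set if whenever $\Phi=\sum_{j=1}^n\mathrm{Ad}_{T_j}\circ\Phi_j$ with $n\ge 1$, $\Phi_j\in\mathrm{CP}^{(P)}(\mathcal{A},\mathscr{B}(\mathcal{H}))$ and $T_j\in\mathscr{B}(\mathcal{H})$ invertible with $\sum_{j=1}^nT_j^*PT_j=P$, there exist invertible $S_j\in\mathscr{B}(\mathcal{H})$ such that $\Phi_j=\mathrm{Ad}_{S_j}\circ\Phi$ for all $1\leq j\leq n$. Linear extreme points are extreme points in the usual convexity sense. *)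

(* Defs.v *)
From HB Require Import structures.
From mathcomp Require Import all_boot all_order all_algebra.
From mathcomp Require Import sesquilinear complex.
From mathcomp Require Import boolp classical_sets functions reals topology.
From mathcomp Require Import normedtype.

Set Implicit Arguments.
Unset Strict Implicit.
Unset Printing Implicit Defensive.
Import Order.TTheory GRing.Theory Num.Theory.
Import numFieldNormedType.Exports.
Local Open Scope classical_set_scope.
Local Open Scope ring_scope.

(* The order of [R[i]] is the partial one: [0 <= z] says that [z] is real and
   nonnegative, so [0 < t < 1] ranges over the real open unit interval. *)

(* The algebra operations are fields here, and the ring structure is derived
   below: a structure inheriting from both [GRing.Algebra] and [NormedModule]
   would be ambiguous with [Num.NumDomain]. *)
HB.mixin Record isCStarAlgebra (R : realType) A
    & CompleteNormedModule R[i] A := {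
  cmul : A -> A -> A;
  cone : A;
  cmulA : associative cmul;
  cmul1l : left_id cone cmul;
  cmul1r : right_id cone cmul;
  cmulDl : left_distributive cmul +%R;
  cmulDr : right_distributive cmul +%R;
  cscaleAl : forall (c : R[i]) (x y : A), c *: cmul x y = cmul (c *: x) y;
  cscaleAr : forall (c : R[i]) (x y : A), c *: cmul x y = cmul x (c *: y);
  cone_neq0 : cone != 0;
  star : A -> A;
  starK : involutive star;
  starD : {morph star : x y / x + y};
  starZ : forall (c : R[i]) (x : A), star (c *: x) = Num.conj c *: star x;
  starM : forall x y : A, star (cmul x y) = cmul (star y) (star x);
  cstar_normM : forall x y : A, `|cmul x y| <= `|x| * `|y|;
  cstar_norm : forall x : A, `|cmul (star x) x| = `|x| ^+ 2
}.

#[short(type="cstarAlgType")]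
HB.structure Definition CStarAlgebra (R : realType) :=
  {A of isCStarAlgebra R A & CompleteNormedModule R[i] A}.

Section CStarRing.
Context {R : realType} (A : cstarAlgType R).

#[non_forgetful_inheritance]
HB.instance Definition _ := GRing.Zmodule_isNzRing.Build A
  (@cmulA R A) (@cmul1l R A) (@cmul1r R A) (@cmulDl R A) (@cmulDr R A)
  (@cone_neq0 R A).
#[non_forgetful_inheritance]
HB.instance Definition _ :=
  GRing.Lmodule_isLalgebra.Build R[i] A (@cscaleAl R A).
#[non_forgetful_inheritance]
HB.instance Definition _ :=
  GRing.Lalgebra_isAlgebra.Build R[i] A (@cscaleAr R A).

End CStarRing.

(* The inner product is linear in its first argument. *)
HB.mixin Record isHilbert (R : realType) H & CompleteNormedModule R[i] H := {
  inner : {dot H for Num.conj};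
  inner_norm : forall x : H, inner x x = `|x| ^+ 2
}.

#[short(type="hilbertType")]
HB.structure Definition Hilbert (R : realType) :=
  {H of isHilbert R H & CompleteNormedModule R[i] H}.

Section BoundedOperators.
Context {R : realType} (H : hilbertType R).

Definition bounded_linear : {pred H -> H} :=
  [pred f | `[< linear f /\ exists M : R[i], forall x, `|f x| <= M * `|x| >]].

Fact bounded_linear_submod_closed : submod_closed bounded_linear.
Proof.
split=> [|c f g /asboolP[lf [M Mf]] /asboolP[lg [N Ng]]]; apply/asboolP; split.
- by move=> a u v; rewrite scaler0 addr0.
- by exists 0 => x; rewrite normr0 mul0r.
- move=> a u v; rewrite /= !fctE lf lg !scalerDr !scalerA mulrC -!addrA.
  by congr (_ + _); rewrite addrCA.
- exists (`|c| * M + N) => x; rewrite /= !fctE mulrDl -mulrA.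
  apply: le_trans (ler_normD _ _) (lerD _ (Ng x)).
  by rewrite normrZ ler_wpM2l.
Qed.

HB.instance Definition _ :=
  GRing.isSubmodClosed.Build _ _ bounded_linear bounded_linear_submod_closed.

Record bop := BOp { bop_fun :> H -> H; _ : bop_fun \in bounded_linear }.

HB.instance Definition _ := [isSub for bop_fun].
HB.instance Definition _ := [Choice of bop by <:].
HB.instance Definition _ := [SubChoice_isSubLmodule of bop by <:].

Lemma bopP (T : bop) :
  linear T /\ exists M : R[i], forall x, `|T x| <= M * `|x|.
Proof. by case: T => f /= /asboolP. Qed.

Lemma eq_bop (S T : bop) : S =1 T -> S = T.
Proof. by move=> ST; apply/val_inj/funext. Qed.

Fact bop_one_subproof : (id : H -> H) \in bounded_linear.
Proof. by apply/asboolP; split=> //; exists 1 => x; rewrite mul1r. Qed.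

Fact bop_mul_subproof (S T : bop) : S \o T \in bounded_linear.
Proof.
apply/asboolP; have [[lS [M HM]] [lT [N HN]]] := (bopP S, bopP T).
split=> [a u v|]; first by rewrite /= lT lS.
exists (`|M| * N) => x; rewrite -mulrA /=.
have M0 (y : H) : M * `|y| <= `|M| * `|y|.
  have /ger0_norm <- : 0 <= M * `|y| by exact: le_trans (normr_ge0 _) (HM y).
  by rewrite normrM normr_id.
apply: le_trans (HM _) _; apply: le_trans (M0 _) _.
by rewrite ler_wpM2l.
Qed.

Definition bop_one := BOp bop_one_subproof.
Definition bop_mul (S T : bop) := BOp (bop_mul_subproof S T).

Fact bop_mulA : associative bop_mul.
Proof. by move=> S T U; exact: eq_bop. Qed.
Fact bop_mul1l : left_id bop_one bop_mul.
Proof. by move=> T; exact: eq_bop. Qed.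
Fact bop_mul1r : right_id bop_one bop_mul.
Proof. by move=> T; exact: eq_bop. Qed.
Fact bop_mulDl : left_distributive bop_mul +%R.
Proof. by move=> S T U; exact: eq_bop. Qed.
Fact bop_mulDr : right_distributive bop_mul +%R.
Proof.
move=> S T U; apply: eq_bop => x; have [lS _] := bopP S.
by have := lS 1 (T x) (U x); rewrite !scale1r.
Qed.

(* Not an [nzRingType]: [H] may be the zero space. *)
HB.instance Definition _ := GRing.Zmodule_isPzRing.Build bop
  bop_mulA bop_mul1l bop_mul1r bop_mulDl bop_mulDr.

End BoundedOperators.

Notation "''B' ( H )" := (bop H) (at level 8, format "''B' ( H )") : type_scope.

Section Operators.
Context {R : realType} {H : hilbertType R}.
Implicit Types S T P X : 'B(H).

Definition is_adjoint T S := forall x y : H, inner (T x) y = inner x (S y).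

(* By the Riesz representation theorem there is exactly one such operator, so
   the default value [0] is never used. *)
Definition adjoint T : 'B(H) := xget 0 [set S | is_adjoint T S].

Definition positive_op P := forall x : H, 0 <= inner (P x) x.

Definition invertible_op T := exists S, S * T = 1 /\ T * S = 1.

Definition Ad T X : 'B(H) := adjoint T * X * T.

(* Positivity of the operator on the Hilbert sum [H^n] with matrix [X]. *)
Definition positive_opmx n (X : 'M['B(H)]_n) :=
  forall xi : 'I_n -> H, 0 <= \sum_i inner (\sum_j X i j (xi j)) (xi i).

End Operators.

Section ExtremePoints.
Context {R : realType} {V : lmodType R[i]}.

Definition extreme_points (K : set V) : set V :=
  [set x | K x /\ forall (y z : V) (t : R[i]), K y -> K z -> 0 < t < 1 ->
             x = t *: y + (1 - t) *: z -> y = x /\ z = x].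

End ExtremePoints.

Section CompletelyPositive.
Context {R : realType} {A : cstarAlgType R} {H : hilbertType R}.
Implicit Types (Phi Psi : A -> 'B(H)) (P : 'B(H)).

Definition states : set (A -> R[i]) :=
  [set psi : A -> R[i] | [/\ scalar psi, forall a, 0 <= psi (star a * a) & psi 1 = 1]].

Definition pure_state : set (A -> R[i]) := extreme_points states.

Definition starmx n (x : 'M[A]_n) : 'M[A]_n := map_mx star x^T.

(* Positive elements of the C*-algebra [M_n(A)]. *)
Definition positive_mx n (x : 'M[A]_n) :=
  exists y : 'M[A]_n, x = starmx y *m y.

Definition CP : set (A -> 'B(H)) :=
  [set Phi | linear Phi /\
     forall n (x : 'M[A]_n), positive_mx x -> positive_opmx (map_mx Phi x)].

Definition cp_le Psi Phi := CP (Phi - Psi).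

Definition pure_CP : set (A -> 'B(H)) :=
  [set Phi | CP Phi /\ forall Psi, CP Psi -> cp_le Psi Phi ->
     exists t : R[i], 0 <= t <= 1 /\ Psi = t *: Phi].

Definition CP_at P : set (A -> 'B(H)) := [set Phi | CP Phi /\ Phi 1 = P].

Definition Cstar_extreme_points P : set (A -> 'B(H)) :=
  [set Phi | CP_at P Phi /\
     forall (n : nat) (Phis : 'I_n -> A -> 'B(H)) (T : 'I_n -> 'B(H)),
       (0 < n)%N ->
       (forall j, CP_at P (Phis j)) ->
       (forall j, invertible_op (T j)) ->
       \sum_j adjoint (T j) * P * T j = P ->
       Phi = \sum_j (Ad (T j) \o Phis j) ->
       exists S : 'I_n -> 'B(H), forall j,
         invertible_op (S j) /\ Phis j = Ad (S j) \o Phi].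

End CompletelyPositive.

(* Main.v *)
Require Import Defs.
From HB Require Import structures.
From mathcomp Require Import all_boot all_order all_algebra.
From mathcomp Require Import sesquilinear spectral complex ring lra.
From mathcomp Require Import boolp classical_sets functions reals topology.
From mathcomp Require Import normedtype.

Set Implicit Arguments.
Unset Strict Implicit.
Unset Printing Implicit Defensive.
Import Order.TTheory GRing.Theory Num.Theory.
Import numFieldNormedType.Exports.
Local Open Scope classical_set_scope.
Local Open Scope ring_scope.

(* The two halves of (i) and (ii) rest on one observation: if [Phi] is a sum of
   maps [Ad_T o Psi], each summand is CP-dominated by [Phi].  When [Phi] is pure
   the summand is a multiple of [Phi]; when [Phi = psi P] with [psi] a pure state,
   the positive functionals [a |-> <Psi a x, x>] are dominated by multiples of
   [psi], hence are multiples of [psi], so [Psi a = psi a Psi 1].  Conjugating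
   back by the invertible [T] identifies the original maps.

   Pure states exist because [a^* a] has nonnegative spectrum, so that the states
   are the linear functionals dominated by a sublinear one (the upper bound of the
   numerical range of the real part).  A minimal element, obtained from Zorn's
   lemma, among the sublinear functionals that cut out a face is linear, and is
   therefore an extreme point; no weak-* compactness is used. *)

(** * The real scalars inside [R[i]] *)

Section RealComplex.
Context {R : realType}.
Implicit Types r s : R.

(** Estimates are carried out in [R], where the order is total and suprema exist; this embedding
    carries them to the scalars of the algebra. *)
Definition rc (r : R) : R[i] := Complex r 0.

Fact rc_is_additive : zmod_morphism rc.
Proof. by move=> r s; apply/eqP; rewrite eq_complex /= subr0 !eqxx. Qed.

Fact rc_is_multiplicative : monoid_morphism rc.
Proof.
split=> // r s.
by apply/eqP; rewrite eq_complex /= !mul0r mulr0 addr0 subr0 !eqxx.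
Qed.

HB.instance Definition _ := GRing.isZmodMorphism.Build R R[i] rc rc_is_additive.
HB.instance Definition _ :=
  GRing.isMonoidMorphism.Build R R[i] rc rc_is_multiplicative.

Lemma rc1 : rc 1 = 1. Proof. by []. Qed.
Lemma rcD r s : rc (r + s) = rc r + rc s. Proof. exact: rmorphD. Qed.
Lemma rcN r : rc (- r) = - rc r. Proof. exact: rmorphN. Qed.
Lemma rcB r s : rc (r - s) = rc r - rc s. Proof. exact: rmorphB. Qed.
Lemma rcM r s : rc (r * s) = rc r * rc s. Proof. exact: rmorphM. Qed.

Lemma le_rc r s : (rc r <= rc s) = (r <= s).
Proof. by rewrite lecE /= eqxx. Qed.

Lemma lt_rc r s : (rc r < rc s) = (r < s).
Proof. by rewrite ltcE /= eqxx. Qed.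

Lemma rc_ge0 r : (0 <= rc r) = (0 <= r).
Proof. by rewrite lecE /= eqxx. Qed.

Lemma rc_gt0 r : (0 < rc r) = (0 < r).
Proof. by rewrite ltcE /= eqxx. Qed.

Lemma rc_inj : injective rc.
Proof. by move=> r s []. Qed.

Lemma rc_Re (z : R[i]) : z \is Num.real -> rc (complex.Re z) = z.
Proof. exact: RRe_real. Qed.

Lemma rc_norm r : `|rc r| = rc `|r|.
Proof. by rewrite normc_def /= expr0n addr0 sqrtr_sqr. Qed.

Lemma conj_rc r : Num.conj (rc r) = rc r.
Proof. by apply/conj_Creal; rewrite complex_real. Qed.

Lemma ge0_rcP (z : R[i]) : 0 <= z -> exists2 r, 0 <= r & z = rc r.
Proof.
move=> z0; exists (complex.Re z); last by rewrite rc_Re// ger0_real.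
by move: z0; rewrite lecE => /andP[].
Qed.

Lemma real_rcP (z : R[i]) : z \is Num.real -> exists r, z = rc r.
Proof. by move=> zr; exists (complex.Re z); rewrite rc_Re. Qed.

Lemma mulCi_complex r s : 'i * Complex r s = Complex (- s) r :> R[i].
Proof.
rewrite -[X in X * _]complexiE; apply/eqP; rewrite eq_complex /=.
by rewrite !mul0r !mul1r sub0r add0r !eqxx.
Qed.

Lemma rc_Ci r s : rc r + 'i * rc s = Complex r s :> R[i].
Proof.
rewrite mulCi_complex; apply/eqP.
by rewrite eq_complex /= oppr0 addr0 add0r !eqxx.
Qed.

End RealComplex.

(** * Real-valued norms and convergence of sequences *)

Section RealNorm.
Context {R : realType} {V : normedModType R[i]}.
Implicit Types (x y z : V) (r : R).

Definition nm x : R := complex.Re `|x|.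

Lemma nmE x : rc (nm x) = `|x|.
Proof. by apply: rc_Re; exact: normr_real. Qed.

Lemma nm_le x r : (nm x <= r) = (`|x| <= rc r).
Proof. by rewrite -nmE le_rc. Qed.

Lemma nm_ge0 x : 0 <= nm x.
Proof. by rewrite -rc_ge0 nmE normr_ge0. Qed.

Lemma nm0 : nm 0 = 0 :> R.
Proof. by rewrite /nm normr0. Qed.

Lemma nmD x y : nm (x + y) <= nm x + nm y.
Proof. by rewrite nm_le rcD !nmE ler_normD. Qed.

Lemma nmN x : nm (- x) = nm x.
Proof. by rewrite /nm normrN. Qed.

Lemma nmBC x y : nm (x - y) = nm (y - x).
Proof. by rewrite /nm distrC. Qed.

Lemma nm_triangle y x z : nm (x - z) <= nm (x - y) + nm (y - z).
Proof. by rewrite (le_trans _ (nmD _ _))// addrA subrK. Qed.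

Lemma nm_eq0 x : nm x = 0 -> x = 0.
Proof. by move=> x0; apply/eqP; rewrite -normr_eq0 -nmE x0. Qed.

Lemma nmZ r x : nm (rc r *: x) = `|r| * nm x.
Proof. by rewrite /nm normrZ rc_norm -nmE -rcM. Qed.

Lemma nm_small x : (forall e, 0 < e -> nm x <= e) -> x = 0.
Proof.
move=> xe; apply: nm_eq0; apply/eqP; rewrite eq_le nm_ge0 andbT.
by apply/ler_addgt0Pr => e /xe; rewrite add0r.
Qed.

Definition ncvg (u : nat -> V) l :=
  forall e : R, 0 < e -> exists N, forall n, (N <= n)%N -> nm (u n - l) <= e.

Lemma ncvg_uniq u l l' : ncvg u l -> ncvg u l' -> l = l'.
Proof.
move=> ul ul'; apply/eqP; rewrite -subr_eq0; apply/eqP/nm_small => e e0.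
have e2 : 0 < e / 2 by lra.
have [[N HN] [N' HN']] := (ul _ e2, ul' _ e2).
have := HN _ (leq_maxl N N'); have := HN' _ (leq_maxr N N').
have := nm_triangle (u (maxn N N')) l l'; rewrite (nmBC l (u _)); lra.
Qed.

Lemma ncvg_bound u l r x : ncvg u l -> (forall n, nm (u n - x) <= r) ->
  nm (l - x) <= r.
Proof.
move=> ul ur; apply/ler_addgt0Pr => e /ul[N /(_ N (leqnn N))].
have := ur N; have := nm_triangle (u N) l x; rewrite (nmBC l (u _)); lra.
Qed.

Lemma ncvgD u v l k : ncvg u l -> ncvg v k -> ncvg (fun n => u n + v n) (l + k).
Proof.
move=> ul vk e e0; have e2 : 0 < e / 2 by lra.
have [[N HN] [M HM]] := (ul _ e2, vk _ e2).
exists (maxn N M) => n; rewrite geq_max => /andP[/HN {}HN /HM {}HM].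
by rewrite opprD addrACA (le_trans (nmD _ _))//; lra.
Qed.

Lemma ncvgZ r u l : ncvg u l -> ncvg (fun n => rc r *: u n) (rc r *: l).
Proof.
move=> ul e e0; have r1 : 0 < `|r| + 1 by rewrite ltr_wpDl.
have [N HN] := ul _ (divr_gt0 e0 r1).
exists N => n /HN; rewrite -scalerBr nmZ ler_pdivlMr//.
have := nm_ge0 (u n - l); have := normr_ge0 r; nra.
Qed.

Lemma ncvg_cst x : ncvg (fun=> x) x.
Proof. by move=> e e0; exists 0%N => n _; rewrite subrr nm0 ltW. Qed.

Lemma ncvg_shift u l : ncvg u l -> ncvg (fun n => u n.+1) l.
Proof. by move=> ul e /ul[N HN]; exists N => n Nn; exact/HN/leqW. Qed.

End RealNorm.

Lemma ncvg_complete {R : realType} {V : completeNormedModType R[i]}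
    (u : nat -> V) :
  (forall e : R, 0 < e -> exists N, forall n m, (N <= n)%N -> (N <= m)%N ->
     nm (u n - u m) <= e) -> exists l, ncvg u l.
Proof.
move=> uC.
have : cauchy (u @ \oo).
  apply/cauchy_ballP => e e0; have [r _ er] := ge0_rcP (ltW e0).
  move: e0; rewrite er rc_gt0 => r0; have r2 : 0 < r / 2 by lra.
  have [N HN] := uC _ r2.
  exists (u @` [set n | (N <= n)%N], u @` [set n | (N <= n)%N]).
    by split; exists N => // n /= Nn; exists n.
  move=> [_ _] [/= [n Nn <-] [m Nm <-]].
  rewrite -ball_normE /ball_ /= -nmE lt_rc.
  by rewrite (le_lt_trans (HN _ _ Nn Nm))//; lra.
move=> /cauchy_cvg/cvg_ex[l /= ul]; exists l => e.
rewrite -rc_gt0 => e0; move/cvgrPdist_le : ul => /(_ _ e0)[N _ HN].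
by exists N => n /HN /=; rewrite nm_le distrC.
Qed.

(** * Reflexive normalization in abelian groups *)

Section AbelianNormalization.
Variable V : zmodType.

Inductive zexp := ZVar of nat | ZZero | ZAdd of zexp & zexp | ZOpp of zexp.

Fixpoint zeval (env : seq V) e : V :=
  match e with
  | ZVar i => nth 0 env i
  | ZZero => 0
  | ZAdd e1 e2 => zeval env e1 + zeval env e2
  | ZOpp e1 => - zeval env e1
  end.

Fixpoint zcoef (i : nat) e : int :=
  match e with
  | ZVar j => (i == j)%:Z
  | ZZero => 0
  | ZAdd e1 e2 => zcoef i e1 + zcoef i e2
  | ZOpp e1 => - zcoef i e1
  end.

(** Reduces equality of expressions to equality of integer coefficients. A variable beyond [env]
    evaluates to the default [0], and its coefficients vanish at every index of the sum. *)
Lemma zeval_coef env e :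
  zeval env e = \sum_(i < size env) nth 0 env i *~ zcoef i e.
Proof.
elim: e => [j||e1 IH1 e2 IH2|e1 IH1] /=.
- have [js|js] := ltnP j (size env).
    rewrite (bigD1 (Ordinal js)) //= eqxx mulr1z big1 ?addr0// => i ij.
    by rewrite (_ : (i == j :> nat) = false) ?mulr0z//; apply/negbTE.
  rewrite nth_default// big1// => i _.
  by rewrite (_ : (i == j :> nat) = false) ?mulr0z// ltn_eqF// (leq_trans _ js).
- by rewrite big1// => i _; rewrite mulr0z.
- by rewrite IH1 IH2 -big_split; apply: eq_bigr => i _; rewrite mulrzDr.
- by rewrite IH1 -sumrN; apply: eq_bigr => i _; rewrite mulrNz.
Qed.

Lemma zeval_eq env e1 e2 :
  all (fun i => zcoef i e1 == zcoef i e2) (iota 0 (size env)) ->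
  zeval env e1 = zeval env e2.
Proof.
move=> /allP e12; rewrite !zeval_coef; apply: eq_bigr => i _.
by rewrite (eqP (e12 _ _))// mem_iota ltn_ord.
Qed.

End AbelianNormalization.

Ltac zfind x env :=
  lazymatch env with
  | ?y :: ?env' =>
      (* The match on a dummy term lets [unify] run while a term is being built; its failure selects
         the second branch, so atoms are compared up to unification. *)
      match constr:(Set) with
      | _ => let _ := match constr:(Set) with _ => unify x y end in constr:(0%N)
      | _ => let n := zfind x env' in constr:(n.+1)
      end
  end.

Ltac zatoms e env :=
  lazymatch e with
  | ?a + ?b => let env := zatoms a env in zatoms b env
  | - ?a => zatoms a env
  | 0 => env
  | _ => match constr:(Set) with
         | _ => let _ := zfind e env in env
         | _ => constr:(e :: env)
         end
  end.

Ltac zreify e env :=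
  lazymatch e with
  | ?a + ?b => let a := zreify a env in let b := zreify b env in constr:(ZAdd a b)
  | - ?a => let a := zreify a env in constr:(ZOpp a)
  | 0 => constr:(ZZero)
  | _ => let n := zfind e env in constr:(ZVar n)
  end.

(* Decides equalities that hold in every abelian group. *)
Ltac abel :=
  lazymatch goal with
  | |- @eq ?V ?a ?b =>
      let env := zatoms a (@nil V) in
      let env := zatoms b env in
      let a' := zreify a env in
      let b' := zreify b env in
      apply: (@zeval_eq _ env a' b'); vm_compute; reflexivity
  end.

(** * Positive elements of a C*-algebra *)

Section CStarBasics.
Context {R : realType} {A : cstarAlgType R}.
Implicit Types (x y z h k : A) (r s t : R).

Lemma starMr x y : star (x * y) = star y * star x.
Proof. exact: starM. Qed.

Lemma star1 : star 1 = 1 :> A.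
Proof. by have := starMr (star 1) 1; rewrite mulr1 starK mulr1 => <-. Qed.

Lemma star0 : star 0 = 0 :> A.
Proof. by apply: (@addrI A (star 0)); rewrite -starD !addr0. Qed.

Lemma starN x : star (- x) = - star x.
Proof. by apply/eqP; rewrite -addr_eq0 -starD addNr star0. Qed.

Lemma starB x y : star (x - y) = star x - star y.
Proof. by rewrite starD starN. Qed.

Lemma starZrc r x : star (rc r *: x) = rc r *: star x.
Proof. by rewrite starZ conj_rc. Qed.

Lemma starZi x : star ('i *: x) = - 'i *: star x.
Proof. by rewrite starZ conjCi. Qed.

Lemma nmM x y : nm (x * y) <= nm x * nm y.
Proof. by rewrite -le_rc rcM !nmE cstar_normM. Qed.

Lemma nm_cstar x : nm (star x * x) = nm x ^+ 2.
Proof. by apply: rc_inj; rewrite expr2 rcM !nmE -expr2 -cstar_norm. Qed.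

(** The C*-identity gives [nm y ^+ 2 <= nm (star y) * nm y], applied to [x] and to [star x]. *)
Lemma nm_star x : nm (star x) = nm x.
Proof.
have le_star y : nm y <= nm (star y).
  have := nmM (star y) y; rewrite nm_cstar.
  have := nm_ge0 y; have := nm_ge0 (star y); nra.
by apply/eqP; rewrite eq_le le_star -{2}(starK x) le_star.
Qed.

Lemma nm1 : nm (1 : A) = 1.
Proof.
have := nm_cstar 1; rewrite star1 mulr1 => n1.
have : nm (1 : A) != 0 by apply/negP => /eqP/nm_eq0/eqP; rewrite oner_eq0.
by move/mulfI; apply; rewrite mulr1 -expr2.
Qed.

Lemma nm_sa_sqr x : star x = x -> nm (x * x) = nm x ^+ 2.
Proof. by move=> {1}<-; exact: nm_cstar. Qed.

Lemma ncvgM (u v : nat -> A) x y : ncvg u x -> ncvg v y ->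
  ncvg (fun n => u n * v n) (x * y).
Proof.
move=> ux vy e e0.
have y1 : 0 < nm y + 1 by rewrite ltr_wpDl ?nm_ge0.
have x1 : 0 < nm x + 1 by rewrite ltr_wpDl ?nm_ge0.
have e2 : 0 < e / 2 by lra.
have [N1 H1] := ux _ (divr_gt0 e2 y1); have [N2 H2] := vy _ ltr01.
have [N3 H3] := vy _ (divr_gt0 e2 x1).
exists (maxn N1 (maxn N2 N3)) => n; rewrite !geq_max => /and3P[/H1 + /H2 + /H3].
rewrite !ler_pdivlMr// => {}H1 {}H2 {}H3.
have -> : u n * v n - x * y = (u n - x) * v n + x * (v n - y).
  by rewrite mulrBl mulrBr addrA subrK.
have vn : nm (v n) <= nm y + 1.
  by have := nmD (v n - y) y; rewrite subrK; lra.
apply: le_trans (nmD _ _) _.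
have := nmM (u n - x) (v n); have := nmM x (v n - y).
have := nm_ge0 (u n - x); have := nm_ge0 (v n - y); have := nm_ge0 x; nra.
Qed.

Lemma ncvg_star (u : nat -> A) x : ncvg u x -> ncvg (star \o u) (star x).
Proof.
by move=> ux e /ux[N HN]; exists N => n /HN; rewrite /= -starB nm_star.
Qed.

(* The iteration [y |-> (x + y ^ 2) / 2] from [0] is dominated by the scalar
   one with [x = 1], which increases and stays below [1]. *)
Lemma fixpoint_half_sqr x : nm x <= 1 -> star x = x ->
  exists y, [/\ star y = y, nm y <= 1, y = rc (2^-1) *: (x + y * y) &
    forall z, GRing.comm z x -> GRing.comm z y].
Proof.
move=> x1 xsa.
pose u n := iter n (fun y => rc 2^-1 *: (x + y * y)) 0.
pose t n : R := iter n (fun s => 2^-1 * (1 + s * s)) 0.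
have uS n : u n.+1 = rc 2^-1 *: (x + u n * u n) by [].
have tS n : t n.+1 = 2^-1 * (1 + t n * t n) by [].
have t01 n : 0 <= t n <= 1.
  elim: n => [|n]; first by rewrite lexx ler01.
  by rewrite tS => /andP[]; nra.
have half : `|2^-1 : R| = 2^-1 by apply: ger0_norm; lra.
have u_t n : nm (u n) <= t n.
  elim: n => [|n IH]; first by rewrite /= nm0.
  rewrite uS tS nmZ half ler_pM2l; last by lra.
  apply: le_trans (nmD _ _) _; apply: lerD x1 _.
  by apply: le_trans (nmM _ _) _; rewrite ler_pM ?nm_ge0.
(* A difference of squares [v * v - w * w] is split as [v * (v - w) + (v - w) * w], where every
   factor is bounded by its scalar counterpart. *)
have step n : nm (u n.+1 - u n) <= t n.+1 - t n.
  elim: n => [|n IH].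
    rewrite uS tS /= !mulr0 !addr0 !subr0 nmZ half mulr1.
    by have := nm_ge0 x; nra.
  have -> : u n.+2 - u n.+1 = rc 2^-1 *: (u n.+1 * u n.+1 - u n * u n).
    by rewrite (uS n.+1) [X in _ - X](uS n) -scalerBr opprD addrACA subrr add0r.
  have -> : t n.+2 - t n.+1 = 2^-1 * (t n.+1 * t n.+1 - t n * t n).
    by have := tS n.+1; have := tS n; lra.
  rewrite nmZ half ler_pM2l; last by lra.
  have -> : u n.+1 * u n.+1 - u n * u n =
      u n.+1 * (u n.+1 - u n) + (u n.+1 - u n) * u n.
    by rewrite mulrBr mulrBl addrA subrK.
  apply: le_trans (nmD _ _) _.
  have := nmM (u n.+1) (u n.+1 - u n); have := nmM (u n.+1 - u n) (u n).
  have := u_t n; have := u_t n.+1; have := nm_ge0 (u n.+1 - u n).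
  have := nm_ge0 (u n); have := nm_ge0 (u n.+1); nra.
have tmono n m : (n <= m)%N -> nm (u m - u n) <= t m - t n.
  move=> /subnK <-; elim: (m - n)%N => [|k IH]; first by rewrite !subrr nm0.
  have := step (k + n)%N; have := nm_triangle (u (k + n)%N) (u (k.+1 + n)%N) (u n).
  by rewrite addSn; lra.
(* Beyond an index where the bounded increasing sequence [t] is within [e] of its supremum, the
   increments of [u] add up to at most [e]. *)
have [y uy] : exists y, ncvg u y.
  apply: ncvg_complete => e e0.
  have supt : has_sup (range t).
    split; first by exists (t 0%N), 0%N.
    by exists 1 => _ [n _ <-]; have /andP[] := t01 n.
  have [_ [N _ <-] HN] := sup_adherent e0 supt.
  have le_t n m : (N <= n)%N -> (n <= m)%N -> nm (u m - u n) <= e.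
    move=> Nn nm'; apply: le_trans (tmono _ _ nm') _.
    have : t m <= sup (range t) by apply: (ub_le_sup supt.2); exists m.
    by have := tmono _ _ Nn; have := nm_ge0 (u n - u N); lra.
  exists N => n m Nn Nm; have [mn|/ltnW nm'] := leqP m n; first exact: le_t.
  by rewrite nmBC; apply: le_t.
exists y; split.
- apply: (ncvg_uniq (ncvg_star uy)); congr ncvg: uy; apply/funext => n /=.
  by elim: n => [|n IH]; rewrite ?star0// uS starZrc starD xsa starMr -IH.
- rewrite -(subr0 y); apply: (ncvg_bound uy) => n; rewrite subr0.
  by apply: le_trans (u_t n) _; have /andP[] := t01 n.
- apply: (ncvg_uniq (ncvg_shift uy)).
  exact: (ncvgZ 2^-1 (ncvgD (ncvg_cst x) (ncvgM uy uy))).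
- move=> z zx; apply: (ncvg_uniq (ncvgM (ncvg_cst z) uy)).
  have /= := ncvgM uy (ncvg_cst z); congr ncvg; apply/funext => n.
  elim: n => [|n IH]; first by rewrite mul0r mulr0.
  by rewrite uS -scalerAl -scalerAr mulrDl mulrDr zx -mulrA IH mulrA IH mulrA.
Qed.

End CStarBasics.

Section CStarPositive.
Context {R : realType} {A : cstarAlgType R}.
Implicit Types (a b c h k p q x y z : A) (r s t : R).

Lemma scale_half_double x : rc 2^-1 *: (x + x) = x.
Proof.
by rewrite scalerDr -scalerDl -rcD (_ : 2^-1 + 2^-1 = 1) ?scale1r//; lra.
Qed.

Lemma scalerii x : 'i *: ('i *: x) = - x.
Proof. by rewrite scalerA -expr2 sqrCi scaleN1r. Qed.

Lemma comm_alg_sub t x h : GRing.comm x h -> GRing.comm x ((rc t)%:A - h).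
Proof. by apply: commrB; rewrite /GRing.comm mulr_algl mulr_algr. Qed.

Lemma star_alg r : star ((rc r)%:A : A) = (rc r)%:A.
Proof. by rewrite starZrc star1. Qed.

Lemma nm_alg r : nm ((rc r)%:A : A) = `|r|.
Proof. by rewrite nmZ nm1 mulr1. Qed.

(* For self-adjoint [h] this says that the spectrum of [h] is nonnegative. *)
Definition cpos h := star h = h /\ exists t : R, nm ((rc t)%:A - h) <= t.

(** Write [h = t (1 - x)] with [|x| <= 1]. The fixed point [y = (x + y^2) / 2] satisfies
    [(1 - y)^2 = 1 - x], so the root is [sqrt t (1 - y)], and [|y| <= 1] makes it positive. *)
Lemma cpos_sqrt h : cpos h -> exists b, [/\ cpos b, b * b = h &
  forall z, GRing.comm z h -> GRing.comm z b].
Proof.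
move=> [hsa [t ht]]; have t0 : 0 <= t := le_trans (nm_ge0 _) ht.
move: t0; rewrite le_eqVlt => /predU1P[t0|t0].
  have -> : h = 0.
    have := nm_ge0 ((rc t)%:A - h); move: ht; rewrite -t0 scale0r sub0r nmN.
    by move=> h0 h0'; apply: nm_eq0; apply/eqP; rewrite eq_le h0.
  exists 0; split; rewrite ?mulr0//.
  by split; [exact: star0 | exists 0; rewrite scale0r subr0 nm0].
pose x := 1 - rc t^-1 *: h.
have xt : rc t *: x = (rc t)%:A - h.
  by rewrite scalerBr scalerA -rcM mulfV ?gt_eqF// scale1r.
have x1 : nm x <= 1.
  have := nmZ t x; rewrite xt gtr0_norm// => xt'.
  by move: ht; rewrite xt' -{2}[t]mulr1 ler_pM2l.
have xsa : star x = x by rewrite starB star1 starZrc hsa.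
have [y [ysa y1 yE yC]] := fixpoint_half_sqr x1 xsa.
have yy : y * y = y + y - x.
  rewrite {3 4}yE -scalerDl -rcD (_ : 2^-1 + 2^-1 = 1); last by lra.
  by rewrite scale1r addrAC subrr add0r.
exists (rc (Num.sqrt t) *: (1 - y)); split.
- split; first by rewrite starZrc starB star1 ysa.
  exists (Num.sqrt t); rewrite -scalerBr nmZ ger0_norm ?sqrtr_ge0//.
  rewrite (_ : 1 - (1 - y) = y); last by abel.
  by rewrite ler_piMr ?sqrtr_ge0.
- rewrite -scalerAl -scalerAr scalerA -rcM -expr2 sqr_sqrtr ?ltW//.
  rewrite mulrBl mul1r mulrBr mulr1 yy.
  have -> : 1 - y - (y - (y + y - x)) = 1 - x by abel.
  by rewrite scalerBr xt; abel.
- move=> z zh; rewrite /GRing.comm -scalerAl -scalerAr.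
  rewrite mulrBl mulrBr mulr1 mul1r yC//.
  by rewrite /GRing.comm mulrBl mulrBr mulr1 mul1r -scalerAl -scalerAr zh.
Qed.

Lemma cposZ r h : 0 <= r -> cpos h -> cpos (rc r *: h).
Proof.
move=> r0 [hsa [t ht]]; split; first by rewrite starZrc hsa.
exists (r * t); rewrite rcM -scalerA -scalerBr nmZ ger0_norm//.
exact: ler_wpM2l.
Qed.

Lemma cposD h k : cpos h -> cpos k -> cpos (h + k).
Proof.
move=> [hsa [t ht]] [ksa [s ks]]; split; first by rewrite starD hsa ksa.
exists (t + s); rewrite rcD scalerDl opprD addrACA.
exact: le_trans (nmD _ _) (lerD ht ks).
Qed.

Lemma cpos_alg_sub t h : star h = h -> nm h <= t -> cpos ((rc t)%:A - h).
Proof.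
move=> hsa ht; split; first by rewrite starB star_alg hsa.
by exists t; rewrite (_ : _ - (_ - h) = h)//; abel.
Qed.

(* [u = h + i b] satisfies [u^* u = t]. *)
Lemma nm_sqr_le_pythagoras t h b : 0 <= t -> star h = h -> star b = b ->
  GRing.comm h b -> h * h + b * b = (rc t)%:A -> nm h ^+ 2 <= t.
Proof.
move=> t0 hsa bsa hb hhbb; pose u := h + 'i *: b.
have su : star u = h - 'i *: b by rewrite starD starZi hsa bsa scaleNr.
have uu : star u * u = (rc t)%:A.
  rewrite su mulrDr !mulrBl -!(scalerAl, scalerAr) scalerii -hb.
  by rewrite -hhbb; abel.
have nu : nm u ^+ 2 = t by rewrite -nm_cstar uu nm_alg ger0_norm.
have -> : h = rc 2^-1 *: (u + star u).
  by rewrite su addrACA subrr addr0 scale_half_double.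
rewrite -nu ler_sqr ?nnegrE ?nm_ge0// nmZ ger0_norm; last by lra.
by have := nmD u (star u); rewrite nm_star; lra.
Qed.

(** Scale to [|g| = 1]. Then [1 - g^2] has a self-adjoint root [b] commuting with [g], and
    [b^2 + g^2 = 1] yields [|1 - g^2| = |b|^2 <= 1]. *)
Lemma cpos_sqr h : star h = h -> cpos (h * h).
Proof.
move=> hsa; have [h0|h0] := eqVneq (nm h) 0.
  rewrite (nm_eq0 h0) mulr0; split; first exact: star0.
  by exists 0; rewrite scale0r subr0 nm0.
have hgt0 : 0 < nm h by rewrite lt_neqAle eq_sym h0 nm_ge0.
pose g := rc (nm h)^-1 *: h.
have gsa : star g = g by rewrite starZrc hsa.
have ng : nm g = 1 by rewrite nmZ gtr0_norm ?invr_gt0// mulVf.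
have hE : h = rc (nm h) *: g by rewrite scalerA -rcM mulfV// scale1r.
have -> : h * h = rc (nm h ^+ 2) *: (g * g).
  by rewrite expr2 [in LHS]hE -scalerAl -scalerAr scalerA -rcM.
apply: cposZ; first exact: sqr_ge0.
have ggsa : star (g * g) = g * g by rewrite starMr gsa.
have /cpos_sqrt[b [[bsa _] bb bC]] : cpos ((rc 1)%:A - g * g).
  by apply: cpos_alg_sub => //; rewrite nm_sa_sqr// ng expr1n.
split=> //; exists 1; rewrite -bb nm_sa_sqr//.
apply: (@nm_sqr_le_pythagoras 1 b g) => //; last by rewrite bb subrK.
by apply/esym/bC/comm_alg_sub; rewrite /GRing.comm mulrA.
Qed.

(** The square roots commute as well, so the product is the square of a self-adjoint element. *)
Lemma cpos_mul h k : cpos h -> cpos k -> GRing.comm h k -> cpos (h * k).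
Proof.
move=> /cpos_sqrt[b [[bsa _] <- bC]] /cpos_sqrt[c [[csa _] kk cC]] hk.
rewrite -kk in hk *.
have cb : GRing.comm b c.
  by apply/cC; rewrite -kk; apply/esym/bC/esym.
have -> : b * b * (c * c) = (b * c) * (b * c).
  by rewrite -!mulrA (mulrA c b) -cb -!mulrA.
by apply: cpos_sqr; rewrite starMr bsa csa cb.
Qed.

(** The roots [b] of [q] and [c] of [t - q] commute and satisfy [b^2 + c^2 = t]. *)
Lemma cpos_nm_le t q : 0 <= t -> cpos q -> cpos ((rc t)%:A - q) -> nm q <= t.
Proof.
move=> t0 /cpos_sqrt[b [[bsa _] bb bC]] /cpos_sqrt[c [[csa _] cc cC]].
rewrite -bb nm_sa_sqr//; apply: (@nm_sqr_le_pythagoras t b c) => //.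
  by apply/cC/comm_alg_sub; rewrite /GRing.comm -bb mulrA.
by rewrite bb cc addrC subrK.
Qed.

Lemma cpos_nm_mono x y : cpos x -> cpos (y - x) -> nm x <= nm y.
Proof.
move=> x0 yx0; apply: cpos_nm_le => //; first exact: nm_ge0.
have -> : (rc (nm y))%:A - x = ((rc (nm y))%:A - y) + (y - x).
  by rewrite addrA subrK.
apply: cposD => //; apply: cpos_alg_sub => //.
by rewrite -(subrK x y) starD yx0.1 x0.1.
Qed.

Lemma cpos_nm_alg_sub t p : cpos p -> nm p <= t -> nm ((rc t)%:A - p) <= t.
Proof.
move=> p0 pt; have t0 := le_trans (nm_ge0 p) pt.
apply: cpos_nm_le => //; first by apply: cpos_alg_sub => //; exact: p0.1.
by rewrite opprB addrCA subrr addr0.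
Qed.

(* With [p = c c^*], which is positive by the identity below, and [t = |c|^2],
   [c^* (t - p) c = - (t q + q^2)] has norm at most [t^2], whereas
   [t q + q^2 >= 2 q^2] has norm at least [2 t^2]. *)
Lemma star_mul_neg c : cpos (- (star c * c)) -> c = 0.
Proof.
have [q cc] : exists q, star c * c = - q by exists (- (star c * c)); rewrite opprK.
rewrite cc opprK => q0.
pose p := c * star c; have psa : star p = p by rewrite starMr starK.
have p0 : cpos p.
  have -> : p = rc 2^-1 *: ((c + star c) * (c + star c) +
      ('i *: (c - star c)) * ('i *: (c - star c))) + q.
    rewrite -scalerAl -scalerAr scalerii.
    rewrite mulrBl !mulrBr !mulrDl !mulrDr cc -/p.
    rewrite [X in _ *: X](_ : _ = (p - q) + (p - q)); last by abel.
    by rewrite scale_half_double subrK.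
  apply: cposD => //; apply: cposZ; first by lra.
  apply: cposD; apply: cpos_sqr; first by rewrite starD starK addrC.
  by rewrite starZi starB starK scaleNr -scalerN opprB.
pose t := nm c ^+ 2; have qt : nm q = t by rewrite -nmN -cc nm_cstar.
have pt : nm p = t by rewrite /t -(nm_star c) -nm_cstar starK.
have bound : nm ((rc t) *: q + q * q) <= t * t.
  rewrite -nmN; have -> : - (rc t *: q + q * q) = star c * ((rc t)%:A - p) * c.
    rewrite mulrBr mulrBl mulr_algr -scalerAl cc /p.
    by rewrite -!mulrA cc mulrA cc mulrNN scalerN opprD.
  apply: le_trans (nmM _ _) _; rewrite (le_trans (ler_wpM2r _ (nmM _ _))) ?nm_ge0//.
  rewrite nm_star mulrAC -expr2 ler_wpM2l ?sqr_ge0//.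
  by apply: cpos_nm_alg_sub; rewrite ?pt.
have : nm (rc 2 *: (q * q)) <= nm ((rc t) *: q + q * q).
  apply: cpos_nm_mono; first by apply: cposZ => //; apply: cpos_sqr; exact: q0.1.
  have -> : rc t *: q + q * q - rc 2 *: (q * q) = q * ((rc t)%:A - q).
    rewrite mulrBr mulr_algr -addrA; congr (_ + _).
    rewrite (_ : rc 2 = 1 + 1) ?scalerDl ?scale1r ?opprD ?addrA ?subrr ?add0r//.
    by rewrite -rc1 -rcD.
  apply: cpos_mul => //; first by apply: cpos_alg_sub; rewrite ?qt//; exact: q0.1.
  exact: comm_alg_sub.
rewrite nmZ ger0_norm// nm_sa_sqr ?qt; last exact: q0.1.
move=> tt; have t0 : t = 0.
  by have : 0 <= t := sqr_ge0 _; nra.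
by apply: nm_eq0; apply/eqP; rewrite -sqrf_eq0 -/t t0.
Qed.

(* With [h = a^* a], [m = |h|] and [k = m - h]: [k^2 = 2 m k], so [c = a k]
   satisfies [c^* c = k h k = - m k^2 <= 0]. *)
Lemma cpos_star_mul a : cpos (star a * a).
Proof.
set h := star a * a; have hsa : star h = h by rewrite starMr starK.
have [m [m0 mm mC]] := cpos_sqrt (cpos_sqr hsa); have msa := m0.1.
have hm : h * m = m * h by apply: mC; rewrite /GRing.comm mulrA.
pose k := m - h; have ksa : star k = k by rewrite starB msa hsa.
have km : k * m = m * k by rewrite mulrBr mulrBl hm.
have kk : k * k = m * k + m * k.
  by rewrite mulrBr !mulrBl mulrBr hm -mm; abel.
have hk : h * k = - (m * k) by rewrite !mulrBr hm -mm; abel.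
have cc : star (a * k) * (a * k) = - (m * (k * k)).
  by rewrite starMr ksa -mulrA (mulrA (star a)) hk mulrN !mulrA km.
have c0 : a * k = 0.
  apply: star_mul_neg; rewrite cc opprK; apply: cpos_mul => //.
    exact: cpos_sqr.
  by rewrite /GRing.comm mulrA -km -mulrA -km mulrA.
(* From [m k^2 = 0] and [k^2 = 2 m k] follow [k^3 = 0] and [k^4 = 0]; the C*-identity for
   self-adjoint elements then descends to [k^2] and to [k]. *)
have mkk : m * (k * k) = 0.
  by apply: oppr_inj; rewrite -cc c0 mulr0 oppr0.
have kkk : k * k * k = 0 by rewrite {1}kk mulrDl -mulrA mkk addr0.
have kk0 : k * k = 0.
  apply: nm_eq0; apply/eqP; rewrite -sqrf_eq0 -nm_sa_sqr ?starMr ?ksa//.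
  by rewrite mulrA kkk mul0r nm0.
have k0 : k = 0.
  by apply: nm_eq0; apply/eqP; rewrite -sqrf_eq0 -nm_sa_sqr// kk0 nm0.
by rewrite (_ : h = m)//; apply/esym/eqP; rewrite -subr_eq0 -/k k0.
Qed.

End CStarPositive.

(** * Extreme linear functionals below a sublinear functional *)

Section SublinearFunctionals.
Context {R : realType} {V : lmodType R[i]}.
Implicit Types (x y a : V) (r s t : R) (f g h p q : V -> R).

Definition real_linear f :=
  (forall x y, f (x + y) = f x + f y) /\ (forall r x, f (rc r *: x) = r * f x).

Definition sublinear q :=
  (forall x y, q (x + y) <= q x + q y) /\
  (forall r x, 0 <= r -> q (rc r *: x) = r * q x).

(** The reverse inequality in homogeneity is the given one for [r^-1] at [rc r *: x]. *)
Lemma sublinearP q : (forall x y, q (x + y) <= q x + q y) -> q 0 = 0 ->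
  (forall r x, 0 < r -> q (rc r *: x) <= r * q x) -> sublinear q.
Proof.
move=> qD q0 qZ; split=> // r x; rewrite le_eqVlt => /predU1P[<-|r0].
  by rewrite scale0r mul0r.
apply/eqP; rewrite eq_le qZ//=.
have := qZ r^-1 (rc r *: x); rewrite invr_gt0 scalerA -rcM mulVf ?gt_eqF//.
by rewrite scale1r => /(_ r0); rewrite mulrC ler_pdivlMr// mulrC.
Qed.

Lemma sublinear0 q : sublinear q -> q 0 = 0.
Proof. by move=> [_ /(_ 0 0 (lexx _))]; rewrite scale0r mul0r. Qed.

Lemma sublinearN q x : sublinear q -> - q (- x) <= q x.
Proof.
by move=> qs; have := qs.1 x (- x); rewrite subrr sublinear0//; lra.
Qed.

Lemma real_linearN f x : real_linear f -> f (- x) = - f x.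
Proof.
move=> [fD fZ]; have := fZ (-1) x; rewrite rcN rc1 scaleN1r => ->.
by rewrite mulN1r.
Qed.

Lemma real_linear_le f g :
  real_linear f -> real_linear g -> (forall x, f x <= g x) -> f = g.
Proof.
move=> fl gl fg; apply/funext => x; apply/eqP; rewrite eq_le fg.
by have := fg (- x); rewrite !real_linearN// lerN2.
Qed.

(* The linear functionals below [q] form a face of those below [p]. *)
Definition sublinear_face p q := forall f g s, real_linear f -> real_linear g ->
  0 < s < 1 -> (forall x, f x <= p x) -> (forall x, g x <= p x) ->
  (forall x, s * f x + (1 - s) * g x <= q x) ->
  (forall x, f x <= q x) /\ (forall x, g x <= q x).

(* The functionals [f <= max_at q a] are the [f <= q] with [f a = q a]. *)
Definition max_at q a x :=
  inf [set q (x + rc t *: a) - t * q a | t in [set t | 0 <= t]].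

Lemma max_at_le q a t x : sublinear q -> 0 <= t ->
  max_at q a x <= q (x + rc t *: a) - t * q a.
Proof.
move=> qs t0; apply: ge_inf; last by exists t.
(* This lower bound guarantees that the infimum is a genuine one. *)
exists (- q (- x)) => _ [s /= s0 <-]; have := qs.1 (x + rc s *: a) (- x).
by rewrite addrAC subrr add0r (qs.2 s a s0); lra.
Qed.

Lemma le_max_at q a x m :
  (forall t, 0 <= t -> m <= q (x + rc t *: a) - t * q a) -> m <= max_at q a x.
Proof.
move=> mq; apply: lb_le_inf; last by move=> _ [t t0 <-]; exact: mq.
by exists (q (x + rc 0 *: a) - 0 * q a), 0 => /=.
Qed.

Lemma max_at_le_self q a x : sublinear q -> max_at q a x <= q x.
Proof.
move=> qs; have := max_at_le a x qs (lexx 0).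
by rewrite scale0r addr0 mul0r subr0.
Qed.

Lemma max_at_opp q a : sublinear q -> max_at q a (- a) <= - q a.
Proof.
move=> qs; have := max_at_le a (- a) qs ler01.
by rewrite scale1r addNr sublinear0// mul1r sub0r.
Qed.

(** Parameters [t] and [s] for the two summands are matched by [t + s] for the sum, and [t] for [x]
    by [r * t] for the multiple of [x] by [r]. *)
Lemma sublinear_max_at q a : sublinear q -> sublinear (max_at q a).
Proof.
move=> qs; apply: sublinearP => [x y||r x r0].
- rewrite -lerBlDl; apply: le_max_at => t t0; rewrite lerBlDl -lerBlDr.
  apply: le_max_at => s s0; rewrite lerBlDl.
  apply: le_trans (max_at_le a (x + y) qs (addr_ge0 t0 s0)) _.
  have := qs.1 (y + rc t *: a) (x + rc s *: a).
  by rewrite addrACA -scalerDl -rcD (addrC y); lra.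
- apply/eqP; rewrite eq_le; apply/andP; split.
    by have := max_at_le_self a 0 qs; rewrite (sublinear0 qs).
  by apply: le_max_at => t t0; rewrite add0r qs.2// subrr.
- rewrite mulrC -ler_pdivrMr//; apply: le_max_at => t t0.
  rewrite ler_pdivrMr//.
  apply: le_trans (max_at_le a _ qs (mulr_ge0 (ltW r0) t0)) _.
  rewrite rcM -scalerA -scalerDr qs.2 ?(ltW r0)//; lra.
Qed.

(** At [- a] the convex combination is at most [- q a], so at [a] it is at least [q a]; as [f a] and
    [g a] are at most [q a], both equal it. *)
Lemma sublinear_face_max_at p q a : sublinear q -> (forall x, q x <= p x) ->
  sublinear_face p q -> sublinear_face p (max_at q a).
Proof.
move=> qs qp qF f g s fl gl s01 fp gp fgq.
have [fq gq] := qF f g s fl gl s01 fp gp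
  (fun x => le_trans (fgq x) (max_at_le_self a x qs)).
have /andP[s0 s1] := s01.
have fga : s * f a + (1 - s) * g a >= q a.
  have := le_trans (fgq (- a)) (max_at_opp a qs).
  by rewrite !real_linearN//; lra.
have fa : f a = q a by have := fq a; have := gq a; nra.
have ga : g a = q a by have := fq a; have := gq a; nra.
split=> x; apply: le_max_at => t t0.
  by have := fq (x + rc t *: a); rewrite fl.1 fl.2 fa; lra.
by have := gq (x + rc t *: a); rewrite gl.1 gl.2 ga; lra.
Qed.

Lemma exists_extreme_real_linear p : sublinear p ->
  exists f, [/\ real_linear f, forall x, f x <= p x &
    forall g h s, real_linear g -> real_linear h -> 0 < s < 1 ->
      (forall x, g x <= p x) -> (forall x, h x <= p x) ->
      (forall x, f x = s * g x + (1 - s) * h x) -> g = f /\ h = f].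
Proof.
move=> ps.
pose good q := [/\ sublinear q, forall x, q x <= p x & sublinear_face p q].
pose T := {q | good q}.
(* The order is reversed, so that a maximal element is pointwise minimal; the infimum of a nonempty
   chain serves as its upper bound. *)
pose rel (q1 q2 : T) := `[< forall x, sval q2 x <= sval q1 x >].
have pgood : good p by [].
have [||||[q [qs qp qF]] qmax] := @Zorn T rel.
- by move=> q; apply/asboolP.
- move=> q1 q2 q3 /asboolP q12 /asboolP q23; apply/asboolP => x.
  exact: le_trans (q23 x) (q12 x).
- move=> [q1 g1] [q2 g2] /asboolP q12 /asboolP q21; apply: eq_exist.
  by apply/funext => x; apply/eqP; rewrite eq_le q21 q12.
- move=> C Ctot; have [[q0 Cq0]|C0] := pselect (exists q : T, C q); last first.
    by exists (exist _ p pgood) => q Cq; case: C0; exists q.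
  pose m x := inf [set sval k x | k in C].
  have m_le x (q : T) : C q -> m x <= sval q x.
    move=> Cq; apply: ge_inf; last by exists q.
    exists (- p (- x)) => _ [[q' /= [qs' qp' _]] _ <-].
    by apply: le_trans (sublinearN x qs'); rewrite lerN2.
  have le_m x b : (forall q : T, C q -> b <= sval q x) -> b <= m x.
    move=> bq; apply: lb_le_inf; first by exists (sval q0 x), q0.
    by move=> _ [q Cq <-]; exact: bq.
  suff mgood : good m.
    by exists (exist _ m mgood) => q Cq; apply/asboolP => x; exact: m_le.
  split.
  + apply: sublinearP => [x y||r x r0].
    * rewrite -lerBlDl; apply: (le_m _ _) => q1 Cq1; rewrite lerBlDl -lerBlDr.
      apply: (le_m _ _) => q2 Cq2; rewrite lerBlDl.
      (* Subadditivity of the smaller of the two chain members bounds the sum. *)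
      have [/asboolP q12|/asboolP q21] := Ctot _ _ Cq1 Cq2.
        apply: le_trans (m_le _ _ Cq2) _; have [qs2 _ _] := svalP q2.
        by have := qs2.1 x y; have := q12 y; lra.
      apply: le_trans (m_le _ _ Cq1) _; have [qs1 _ _] := svalP q1.
      by have := qs1.1 x y; have := q21 x; lra.
    * apply/eqP; rewrite eq_le; apply/andP; split.
        apply: le_trans (m_le _ _ Cq0) _; have [qs0 _ _] := svalP q0.
        by rewrite sublinear0.
      by apply: (le_m _ _) => -[q [qs _ _]] _ /=; rewrite sublinear0.
    * rewrite mulrC -ler_pdivrMr//; apply: (le_m _ _) => q Cq.
      rewrite ler_pdivrMr//.
      apply: le_trans (m_le _ _ Cq) _; have [qs _ _] := svalP q.
      by rewrite qs.2 ?(ltW r0)// mulrC.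
  + move=> x; apply: le_trans (m_le _ _ Cq0) _.
    by have [_ + _] := svalP q0.
  + move=> f g s fl gl s01 fp gp fgm.
    have fgq (q : T) : C q ->
        (forall x, f x <= sval q x) /\ (forall x, g x <= sval q x).
      move=> Cq; have [_ _ qF] := svalP q; apply: (qF f g s) => // x.
      exact: le_trans (fgm x) (m_le _ _ Cq).
    by split=> x; apply: (le_m _ _) => q /fgq[].
(* Minimality applies because [max_at q a] is good and lies below [q]. With [max_at_opp] this makes
   [q] odd, and an odd sublinear functional is linear. *)
have qE a : max_at q a = q.
  have agood : good (max_at q a).
    split; [exact: sublinear_max_at | | exact: sublinear_face_max_at].
    by move=> x; apply: le_trans (qp x); exact: max_at_le_self.
  have := qmax (exist _ _ agood); move=> /(_ _)/(congr1 sval) /= -> //.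
  by apply/asboolP => x /=; exact: max_at_le_self.
have qN a : q (- a) = - q a.
  apply/eqP; rewrite eq_le -{1}(qE a) max_at_opp//=.
  by have := sublinearN a qs; lra.
have ql : real_linear q.
  split=> [x y|r x].
    apply/eqP; rewrite eq_le qs.1/=; have := qs.1 (- x) (- y).
    by rewrite -opprD !qN; lra.
  have [r0|r0] := leP 0 r; first exact: qs.2.
  have := qs.2 (- r) x; rewrite rcN scaleNr qN => /(_ _); rewrite oppr_ge0 ltW//.
  by move=> /(_ isT); lra.
exists q; split=> // g h s gl hl s01 gp hp qgh.
have ghq x : s * g x + (1 - s) * h x <= q x by rewrite -qgh.
have [gq hq] := qF g h s gl hl s01 gp hp ghq.
by split; exact: real_linear_le.
Qed.

End SublinearFunctionals.

(** * Existence of pure states *)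

Section PureStates.
Context {R : realType} {A : cstarAlgType R}.
Implicit Types (a b h x y z : A) (r s t : R).

Definition positive_functional (phi : A -> R[i]) :=
  scalar phi /\ forall a, 0 <= phi (star a * a).

Lemma scalarD (phi : A -> R[i]) x y : scalar phi -> phi (x + y) = phi x + phi y.
Proof. by move=> phil; have := phil 1 x y; rewrite scale1r mul1r. Qed.

Lemma scalar0 (phi : A -> R[i]) : scalar phi -> phi 0 = 0.
Proof. by move=> phil; apply: (@addrI _ (phi 0)); rewrite -scalarD// !addr0. Qed.

Lemma scalarZr (phi : A -> R[i]) c x : scalar phi -> phi (c *: x) = c * phi x.
Proof. by move=> phil; have := phil c x 0; rewrite addr0 scalar0// addr0. Qed.

Lemma scalarNr (phi : A -> R[i]) x : scalar phi -> phi (- x) = - phi x.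
Proof. by move=> phil; rewrite -scaleN1r scalarZr// mulN1r. Qed.

Lemma positive_functional_cpos phi h :
  positive_functional phi -> cpos h -> 0 <= phi h.
Proof. by move=> [_ phi0] /cpos_sqrt[b [[bsa _] <- _]]; rewrite -{1}bsa. Qed.

Lemma positive_functional_real phi h :
  positive_functional phi -> star h = h -> phi h \is Num.real.
Proof.
move=> phip hsa; have [phil phi0] := phip.
have -> : h = (rc (nm h))%:A - ((rc (nm h))%:A - h) by abel.
have p1 : 0 <= phi 1 by have := phi0 1; rewrite star1 mulr1.
rewrite scalarD// scalarNr// scalarZr// rpredB// ger0_real//.
  by rewrite mulr_ge0// rc_ge0 nm_ge0.
by apply: positive_functional_cpos => //; exact: cpos_alg_sub.
Qed.

Definition re x := rc 2^-1 *: (x + star x).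

Lemma star_re x : star (re x) = re x.
Proof. by rewrite starZrc starD starK addrC. Qed.

Lemma re_sa h : star h = h -> re h = h.
Proof.
by move=> hsa; rewrite /re hsa scale_half_double.
Qed.

Lemma reD x y : re (x + y) = re x + re y.
Proof. by rewrite /re starD addrACA scalerDr. Qed.

Lemma reZ r x : re (rc r *: x) = rc r *: re x.
Proof. by rewrite /re starZrc -scalerDr !scalerA mulrC. Qed.

Lemma reN x : re (- x) = - re x.
Proof. by rewrite /re starN -opprD scalerN. Qed.

Lemma re_i h : star h = h -> re ('i *: h) = 0.
Proof. by move=> hsa; rewrite /re starZi hsa scaleNr subrr scaler0. Qed.

Lemma re_im_decomp x : x = re x + 'i *: re (- ('i *: x)).
Proof.
rewrite {2}/re starN starZi scaleNr opprK scalerA mulrC -scalerA scalerDr scalerN.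
rewrite !scalerii opprK -scalerDr.
by rewrite (_ : x + star x + (x - star x) = x + x) ?scale_half_double//; abel.
Qed.

Lemma positive_functional_Re phi x :
  positive_functional phi -> rc (complex.Re (phi x)) = phi (re x).
Proof.
move=> phip; have phil := phip.1.
rewrite {1}(re_im_decomp x) scalarD// (scalarZr 'i (re _) phil).
have := positive_functional_real phip (star_re x).
have := positive_functional_real phip (star_re (- ('i *: x))).
by move=> /real_rcP[u ->] /real_rcP[v ->]; rewrite rc_Ci.
Qed.

(** Chosen so that the real-linear functionals below it are exactly the real parts of states: see
    [positive_functional_upper_bound] and [states_complexify]. *)
Definition upper_bound x : R := inf [set t : R | cpos ((rc t)%:A - re x)].

Lemma cpos_alg_ge0 t : cpos ((rc t)%:A : A) -> 0 <= t.
Proof.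
move=> [_ [s]]; rewrite -scalerBl -rcB nm_alg => st.
by have := ler_norm (s - t); lra.
Qed.

Lemma upper_bound_le x t : cpos ((rc t)%:A - re x) -> upper_bound x <= t.
Proof.
(* If [s - re x] is positive, adding the positive element [|re x| + re x] gives the positive scalar
   [s + |re x|]. *)
move=> xt; apply: ge_inf => //; exists (- nm (re x)) => s xs.
rewrite -subr_ge0 opprK; apply: cpos_alg_ge0.
rewrite rcD scalerDl -(subrK (re x) ((rc s)%:A)) -addrA addrC.
have -> : re x + (rc (nm (re x)))%:A + ((rc s)%:A - re x) =
   ((rc (nm (re x)))%:A - (- re x)) + ((rc s)%:A - re x) by abel.
by apply: cposD => //; apply: cpos_alg_sub; rewrite ?nmN// starN star_re.
Qed.

Lemma le_upper_bound x m :
  (forall t, cpos ((rc t)%:A - re x) -> m <= t) -> m <= upper_bound x.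
Proof.
move=> mx; apply: lb_le_inf => [|t]; last exact: mx.
by exists (nm (re x)); apply: cpos_alg_sub => //; exact: star_re.
Qed.

Lemma sublinear_upper_bound : sublinear upper_bound.
Proof.
have re0 : re 0 = 0 by rewrite re_sa ?star0.
apply: sublinearP => [x y||r x r0].
- rewrite -lerBlDl; apply: le_upper_bound => t yt; rewrite lerBlDl -lerBlDr.
  apply: le_upper_bound => s xs; rewrite lerBlDr; apply: upper_bound_le.
  by rewrite reD rcD scalerDl opprD addrACA; apply: cposD.
- apply/eqP; rewrite eq_le; apply/andP; split.
    apply: upper_bound_le; rewrite re0 scale0r subr0 -(mulr0 0).
    by apply: cpos_sqr; rewrite star0.
  by apply: le_upper_bound => t; rewrite re0 subr0; exact: cpos_alg_ge0.
- rewrite mulrC -ler_pdivrMr//; apply: le_upper_bound => t xt.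
  rewrite ler_pdivrMr//; apply: upper_bound_le.
  by rewrite reZ mulrC rcM -scalerA -scalerBr; apply: cposZ => //; exact: ltW.
Qed.

Lemma positive_functional_upper_bound phi x : states phi ->
  complex.Re (phi x) <= upper_bound x.
Proof.
move=> [phil phi0 phi1]; apply: le_upper_bound => t xt.
have phip : positive_functional phi by [].
have := positive_functional_cpos phip xt.
by rewrite scalarD// scalarNr// scalarZr// phi1 mulr1 -positive_functional_Re//
  subr_ge0 le_rc.
Qed.

Lemma scalar_Im phi x : scalar phi ->
  complex.Im (phi x) = complex.Re (phi (- ('i *: x))).
Proof.
move=> phil; rewrite scalarNr// scalarZr//; case: (phi x) => u v.
by rewrite mulCi_complex /= opprK.
Qed.

Lemma real_linear_Re phi : scalar phi -> real_linear (fun x => complex.Re (phi x)).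
Proof.
move=> phil; split=> [x y|r x].
  by rewrite scalarD//; case: (phi x) (phi y) => ? ? [].
by rewrite scalarZr//; case: (phi x) => u v; rewrite /= mul0r subr0.
Qed.

Section Complexification.
Variable f : A -> R.
Hypothesis fl : real_linear f.

(** The imaginary part is forced by [scalar_Im], so this is the only complex-linear functional with
    real part [f]. *)
Definition complexify x : R[i] := Complex (f x) (f (- ('i *: x))).

Lemma scalar_complexify : scalar complexify.
Proof.
have psiD x y : complexify (x + y) = complexify x + complexify y.
  by rewrite /complexify scalerDr opprD !fl.1.
have psiZ r x : complexify (rc r *: x) = rc r * complexify x.
  have ->: complexify (rc r *: x) = Complex (r * f x) (r * f (- ('i *: x))).
    by rewrite /complexify scalerA mulrC -scalerA -scalerN !fl.2.
  by apply/eqP; rewrite eq_complex /= !mul0r subr0 addr0 !eqxx.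
have psii x : complexify ('i *: x) = 'i * complexify x.
  by rewrite /complexify scalerii opprK real_linearN// mulCi_complex opprK.
move=> c x y; rewrite psiD; congr (_ + _).
case: c => u v; rewrite -rc_Ci scalerDl psiD -scalerA psii !psiZ.
by rewrite mulrDl mulrA.
Qed.

Hypothesis f_le : forall x, f x <= upper_bound x.

Lemma le_upper_bound_cpos h : cpos h -> 0 <= f h.
Proof.
move=> h0; rewrite -oppr_le0 -real_linearN//; apply: le_trans (f_le _) _.
by apply: upper_bound_le; rewrite scale0r sub0r reN opprK re_sa//; exact: h0.1.
Qed.

(** The real part of ['i *: h] vanishes, so [f] is at most [0] there, and likewise for [- h]. *)
Lemma le_upper_bound_skew h : star h = h -> f ('i *: h) = 0.
Proof.
have fi_le0 k : star k = k -> f ('i *: k) <= 0.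
  move=> ksa; apply: le_trans (f_le _) _; apply: upper_bound_le.
  by rewrite re_i// subr0 scale0r -(mulr0 0); apply: cpos_sqr; rewrite star0.
move=> hsa; apply/eqP; rewrite eq_le fi_le0//=.
by have := fi_le0 (- h); rewrite starN hsa scalerN real_linearN// => /(_ erefl); lra.
Qed.

Lemma states_complexify : states complexify.
Proof.
split; first exact: scalar_complexify.
  move=> a; have h0 := cpos_star_mul a.
  rewrite /complexify real_linearN// le_upper_bound_skew ?oppr0; last exact: h0.1.
  by rewrite -/(rc _) rc_ge0; exact: le_upper_bound_cpos.
have sa1 : star (1 : A) = 1 by exact: star1.
rewrite /complexify real_linearN// le_upper_bound_skew// oppr0.
suff -> : f 1 = 1 by [].
have cpos0 : cpos (0 : A) by rewrite -(mulr0 0); apply: cpos_sqr; rewrite star0.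
(* The bounds [upper_bound 1 <= 1] and [upper_bound (- 1) <= - 1] enclose [f 1]. *)
apply/eqP; rewrite eq_le; apply/andP; split.
  by apply: le_trans (f_le _) _; apply: upper_bound_le; rewrite re_sa// scale1r subrr.
rewrite -lerN2 -real_linearN//; apply: le_trans (f_le _) _.
by apply: upper_bound_le; rewrite reN re_sa// rcN rc1 scaleN1r subrr.
Qed.

End Complexification.

Lemma exists_pure_state : exists psi : A -> R[i], pure_state psi.
Proof.
have [f [fl f_le fext]] := exists_extreme_real_linear sublinear_upper_bound.
exists (complexify f); split; first exact: states_complexify.
move=> y z t ys zs t01 fE.
have [s _ ts] : exists2 s, 0 <= s & t = rc s by apply: ge0_rcP; case/andP: t01 => /ltW.
move: t01; rewrite ts rc_gt0 -rc1 lt_rc => s01.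
have [yl _ _] := ys; have [zl _ _] := zs.
have [|||] := fext _ _ s (real_linear_Re yl) (real_linear_Re zl) s01.
- by move=> x; exact: positive_functional_upper_bound.
- by move=> x; exact: positive_functional_upper_bound.
- move=> x; have := congr1 (fun g => complex.Re (g x)) fE.
  rewrite /= ts -rc1 -rcB => ->.
  rewrite -[_ x]/(rc s * y x + rc (1 - s) * z x).
  by case: (y x) (z x) => [a b] [c d]; rewrite /= !mul0r !subr0.
(* Extremality was obtained for real parts only; a complex-linear functional is recovered from its
   real part. *)
move=> yf zf; have eq_cplx (phi : A -> R[i]) : scalar phi ->
    (fun x => complex.Re (phi x)) = f -> phi = complexify f.
  move=> phil phif; apply/funext => x; apply/eqP; rewrite eq_complex /= scalar_Im//.
  by rewrite -phif !eqxx.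
by split; apply: eq_cplx.
Qed.

End PureStates.

(** * Riesz representation and adjoints *)

Section HilbertSpace.
Context {R : realType} {H : hilbertType R}.
Implicit Types (x y z u v : H) (r s t : R) (S T X : 'B(H)).

Lemma innerDl x y z : inner (x + y) z = inner x z + inner y z.
Proof. exact: linearDl. Qed.

Lemma innerDr x y z : inner z (x + y) = inner z x + inner z y.
Proof. exact: linearDr. Qed.

Lemma innerZl c x y : inner (c *: x) y = c * inner x y.
Proof. exact: linearZl_LR. Qed.

Lemma innerZr c x y : inner x (c *: y) = Num.conj c * inner x y.
Proof. exact: linearZr_LR. Qed.

Lemma innerNl x y : inner (- x) y = - inner x y.
Proof. exact: linearNl. Qed.

Lemma innerNr x y : inner x (- y) = - inner x y.
Proof. exact: linearNr. Qed.

Lemma inner0l x : inner 0 x = 0.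
Proof. exact: linear0l. Qed.

Lemma innerC x y : inner x y = Num.conj (inner y x).
Proof. by rewrite -[RHS]mul1r -(expr0 (-1)); exact: (hermC (@inner R H)). Qed.

Lemma inner_nm x : inner x x = rc (nm x ^+ 2).
Proof. by rewrite inner_norm expr2 rcM !nmE -expr2. Qed.

Lemma inner_inj u v : (forall x, inner x u = inner x v) -> u = v.
Proof.
move=> uv; apply/eqP; rewrite -subr_eq0; apply/eqP/nm_eq0/eqP.
rewrite -sqrf_eq0; apply/eqP/rc_inj; rewrite -inner_nm innerDr innerNr uv.
by rewrite subrr.
Qed.

Let rin x y : R := complex.Re (inner x y).

Let rinC x y : rin x y = rin y x.
Proof. by rewrite /rin innerC; case: (inner y x). Qed.

Let rinDl x y z : rin (x + y) z = rin x z + rin y z.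
Proof. by rewrite /rin innerDl; case: (inner x z) (inner y z) => ? ? []. Qed.

Let rinZl r x y : rin (rc r *: x) y = r * rin x y.
Proof.
by rewrite /rin innerZl; case: (inner x y) => u v; rewrite /= mul0r subr0.
Qed.

Let nm_sqr x : nm x ^+ 2 = rin x x.
Proof. by rewrite /rin inner_nm. Qed.

Let nm_sqrD x y : nm (x + y) ^+ 2 = nm x ^+ 2 + 2 * rin x y + nm y ^+ 2.
Proof.
rewrite !nm_sqr rinDl ![rin _ (x + y)]rinC !rinDl [rin y x]rinC.
by rewrite (mulr_natl _ 2) mulr2n !addrA.
Qed.

Let nm_sqrB x y : nm (x - y) ^+ 2 = nm x ^+ 2 - 2 * rin x y + nm y ^+ 2.
Proof.
have := nm_sqrD x (- y); rewrite nmN => ->; congr (_ + _ + _).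
by rewrite rinC -scaleN1r -rc1 -rcN rinZl mulN1r rinC mulrN.
Qed.

Lemma Re_inner_le x y : complex.Re (inner x y) <= nm x * nm y.
Proof.
rewrite -/(rin x y); have := nm_sqrD x y.
have : nm (x + y) ^+ 2 <= (nm x + nm y) ^+ 2.
  by rewrite ler_sqr ?nnegrE ?addr_ge0 ?nm_ge0// nmD.
by rewrite sqrrD; lra.
Qed.

(* The vector minimizes [|x|^2 - 2 Re f x]. *)
Lemma riesz (f : H -> R[i]) m : scalar f ->
  (forall x, complex.Re (f x) <= m * nm x) -> exists y, forall x, f x = inner x y.
Proof.
move=> fl fm.
have fD x y : f (x + y) = f x + f y by have := fl 1 x y; rewrite scale1r mul1r.
have f0 : f 0 = 0 by apply: (@addrI _ (f 0)); rewrite -fD !addr0.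
have fZ c x : f (c *: x) = c * f x by have := fl c x 0; rewrite !addr0 f0 addr0.
pose g x := complex.Re (f x).
have gD x y : g (x + y) = g x + g y.
  by rewrite /g fD; case: (f x) (f y) => ? ? [].
have gZ r x : g (rc r *: x) = r * g x.
  by rewrite /g fZ; case: (f x) => u v; rewrite /= mul0r subr0.
have gB x y : g (x - y) = g x - g y.
  by rewrite gD -[- y]scaleN1r -rc1 -rcN gZ mulN1r.
pose J x := nm x ^+ 2 - 2 * g x.
have Jlb x : - m ^+ 2 <= J x.
  by rewrite /J; have := fm x; rewrite -/(g x); have := sqr_ge0 (nm x - m); nra.
pose d := inf (range J).
have infJ : has_inf (range J).
  by split; [exists (J 0), 0 | exists (- m ^+ 2) => _ [x _ <-]].
have dJ x : d <= J x by apply: (ge_inf infJ.2); exists x.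
(* Comparing [d] with the value of [J] at the midpoint shows that minimizing sequences are
   Cauchy. *)
have parallelogram x y : nm (x - y) ^+ 2 <= 2 * (J x - d) + 2 * (J y - d).
  have := dJ (rc 2^-1 *: (x + y)).
  by rewrite /J gZ gD nmZ exprMn nm_sqrB nm_sqrD ger0_norm; lra.
have /choice[u Ju] : forall n : nat, exists x, J x < d + n.+1%:R^-1.
  move=> n; have n0 : 0 < n.+1%:R^-1 :> R by rewrite invr_gt0.
  by have [_ [x _ <-] Jx] := inf_adherent n0 infJ; exists x.
have small e : 0 < e -> exists N, forall n, (N <= n)%N -> J (u n) <= d + e.
  move=> e0; have /archi_boundP : 0 <= e^-1 by rewrite invr_ge0 ltW.
  set N := Num.bound _ => eN; exists N => n Nn; apply: le_trans (ltW (Ju n)) _.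
  rewrite lerD2l -[leRHS]invrK lef_pV2 ?posrE ?invr_gt0//.
  by apply: le_trans (ltW eN) _; rewrite ler_nat (leq_trans Nn).
have [y uy] : exists y, ncvg u y.
  apply: ncvg_complete => e e0; have [N HN] := small (e ^+ 2 / 4) ltac:(nra).
  exists N => n k /HN Jn /HN Jk.
  rewrite -ler_sqr ?nnegrE ?nm_ge0 ?(ltW e0)//; move: Jn Jk (parallelogram (u n) (u k)).
  by move: (J (u n)) (J (u k)) (nm _ ^+ 2) (e ^+ 2) => Jn Jk q e2 ? ? ?; lra.
have Jy x : J y <= J x.
  apply: le_trans (dJ x); apply/ler_addgt0Pr => e e0.
  (* A Lipschitz constant for passing from [u n] to [y] once their distance is at most [1]: a
     distance of at most [e / (2 c)] costs half of [e], and near-minimality of [u n] costs the other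
     half. *)
  pose c := 2 * nm y + 1 + 2 * `|m|.
  have c0 : 0 < c by rewrite /c; have := nm_ge0 y; have := normr_ge0 m; lra.
  have [N1 H1] := small (e / 2) ltac:(lra).
  have [N2 H2] := uy _ (divr_gt0 e0 (mulr_gt0 (ltr0Sn R 1) c0)).
  have [N3 H3] := uy _ ltr01.
  pose n := maxn N1 (maxn N2 N3).
  have := H1 n (leq_maxl _ _).
  have := H2 n; rewrite !leq_max leqnn orbT => /(_ isT).
  have := H3 n; rewrite !leq_max leqnn !orbT => /(_ isT).
  rewrite ler_pdivlMr ?mulr_gt0// -/n => dl1 dlc Jn.
  have un := nmD (y - u n) (u n); have yn := nmD (u n - y) y.
  have := fm (u n - y); rewrite -/(g _) gB; have := ler_norm m => mm gn.
  rewrite subrK nmBC in un; rewrite subrK in yn.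
  have mdl : m * nm (u n - y) <= `|m| * nm (u n - y) by rewrite ler_wpM2r ?nm_ge0.
  have sq : nm y ^+ 2 - nm (u n) ^+ 2 <= nm (u n - y) * (2 * nm y + 1).
    rewrite subr_sqr; have := nm_ge0 y; have := nm_ge0 (u n).
    have := nm_ge0 (u n - y); nra.
  move: Jn; rewrite /J; move: sq mdl gn dlc; rewrite /c; lra.
have first_order z : g z = rin z y.
  pose k := rin z y - g z; pose N := nm z ^+ 2.
  have N1 : 0 < N + 1 by rewrite ltr_wpDl ?sqr_ge0.
  (* Minimality along the line [y + r z]. At [r = - k / (N + 1)] the quadratic equals
     [- (N + 2) w^2], which forces [w = 0]; the [1] in the denominator covers [z = 0]. *)
  have kN r : 0 <= 2 * (r * k) + r ^+ 2 * N.
    have := Jy (y + rc r *: z).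
    rewrite /J gD gZ nm_sqrD nmZ exprMn real_normK ?num_real// rinC rinZl /k /N.
    by lra.
  pose w := k / (N + 1); have kw : k = w * (N + 1) by rewrite divfK// gt_eqF.
  have := kN (- w); rewrite kw => kN'.
  have w0 : w = 0.
    apply/eqP; rewrite -sqrf_eq0 eq_le sqr_ge0 andbT.
    by have := sqr_ge0 (nm z); rewrite -/N; nra.
  by apply/esym/eqP; rewrite -subr_eq0 -/k kw w0 mul0r.
exists y => x; apply/eqP; rewrite eq_complex -/(g x) first_order eqxx /=.
(* Real parts at ['i *: x] supply the imaginary parts at [x]. *)
have := first_order ('i *: x); rewrite /g /rin fZ innerZl.
by case: (f x) (inner x y) => [a b] [c' d']; rewrite !mulCi_complex /= => /oppr_inj ->.
Qed.

(* The bound in [bopP] is a complex number. *)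
Lemma bop_bound T : exists2 m : R, 0 <= m & forall x, nm (T x) <= m * nm x.
Proof.
have [_ [M TM]] := bopP T; have [m m0 mE] := ge0_rcP (normr_ge0 M).
exists m => // x; rewrite -le_rc rcM !nmE -mE.
apply: le_trans (TM x) _.
have /ger0_norm <- : 0 <= M * `|x| by exact: le_trans (normr_ge0 _) (TM x).
by rewrite normrM normr_id.
Qed.

Lemma bopD T x y : T (x + y) = T x + T y.
Proof. by have [Tl _] := bopP T; have := Tl 1 x y; rewrite !scale1r. Qed.

Lemma bop0 T : T 0 = 0.
Proof. by apply: (@addrI _ (T 0)); rewrite -bopD !addr0. Qed.

Lemma bopZ T c x : T (c *: x) = c *: T x.
Proof. by have [Tl _] := bopP T; have := Tl c x 0; rewrite !addr0 bop0 addr0. Qed.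

(** Riesz representation of [x |-> <T x, y>] yields a candidate [S y]; linearity follows from
    uniqueness, and [|S y|^2 = <T (S y), y> <= m |S y| |y|] gives boundedness. *)
Lemma adjointP T : is_adjoint T (adjoint T).
Proof.
rewrite /adjoint; case: xgetP => // noadj; exfalso.
have [m m0 Tm] := bop_bound T.
have /choice[S ST] : forall y, exists z, forall x, inner (T x) y = inner x z.
  move=> y; apply: (@riesz _ (m * nm y)) => [c u v|x].
    by rewrite bopD bopZ innerDl innerZl.
  apply: le_trans (Re_inner_le _ _) _; have := nm_ge0 y; have := Tm x; nra.
have Sb : S \in @bounded_linear R H.
  apply/asboolP; split=> [c u v|].
    by apply: inner_inj => x; rewrite -ST !innerDr !innerZr !ST.
  exists (rc m) => y; rewrite -!nmE -rcM le_rc.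
  have [->|Sy0] := eqVneq (S y) 0; first by rewrite nm0 mulr_ge0// nm_ge0.
  have Sy : 0 < nm (S y).
    rewrite lt_neqAle nm_ge0 andbT eq_sym; apply/eqP => /nm_eq0/eqP.
    by rewrite (negbTE Sy0).
  rewrite -(ler_pM2l Sy) -expr2 (_ : _ ^+ 2 = complex.Re (inner (S y) (S y))).
    rewrite -ST; apply: le_trans (Re_inner_le _ _) _.
    by have := nm_ge0 y; have := Tm (S y); nra.
  by rewrite inner_nm.
by apply: (noadj (BOp Sb)) => x y; rewrite ST.
Qed.

End HilbertSpace.

(** * Completely positive maps *)

Section Operators.
Context {R : realType} {H : hilbertType R}.
Implicit Types (x y z : H) (S T X Y P : 'B(H)).

Lemma inner_suml (I : Type) (r : seq I) (Q : pred I) (F : I -> H) y :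
  inner (\sum_(i <- r | Q i) F i) y = \sum_(i <- r | Q i) inner (F i) y.
Proof. by elim/big_rec2: _ => [|i u v _ <-]; rewrite ?inner0l ?innerDl. Qed.

Lemma inner_sumr (I : Type) (r : seq I) (Q : pred I) (F : I -> H) y :
  inner y (\sum_(i <- r | Q i) F i) = \sum_(i <- r | Q i) inner y (F i).
Proof.
rewrite innerC inner_suml rmorph_sum; apply: eq_bigr => i _; exact/esym/innerC.
Qed.

(** Polarization: the form vanishes on [x + z] and on [x + i z], which makes [<S x, z>] and
    [<S z, x>] both opposite and equal. *)
Lemma inner_bop_eq0 S : (forall x, inner (S x) x = 0) -> S = 0.
Proof.
move=> S0.
have S1 x y : inner (S x) y + inner (S y) x = 0.
  have := S0 (x + y); rewrite bopD innerDl !innerDr !S0 add0r addr0 => <-.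
  by [].
apply: eq_bop => x; apply: inner_inj => z; rewrite [RHS]innerC inner0l conjC0.
rewrite innerC; suff -> : inner (S x) z = 0 by rewrite conjC0.
have h1 := S1 x z; have := S1 x ('i *: z).
rewrite bopZ innerZl innerZr conjCi mulNr addrC -mulrBr => /eqP.
rewrite mulf_eq0 (negbTE (neq0Ci _)) /= subr_eq0 => /eqP h2.
move: h1; rewrite h2 -mulr2n => /eqP; rewrite mulrn_eq0 /= => /eqP //.
Qed.

Lemma inner_bop_inj S T : (forall x, inner (S x) x = inner (T x) x) -> S = T.
Proof.
move=> ST; apply/eqP; rewrite -subr_eq0; apply/eqP/inner_bop_eq0 => x.
by rewrite -[(S - T) x]/(S x - T x) innerDl innerNl ST subrr.
Qed.

Lemma adjointPl T x y : inner (adjoint T x) y = inner x (T y).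
Proof. by rewrite innerC -adjointP -innerC. Qed.

Lemma inner_Ad T X x y : inner (Ad T X x) y = inner (X (T x)) (T y).
Proof. by rewrite -[Ad T X x]/(adjoint T (X (T x))) adjointPl. Qed.

Lemma Ad_inj T X Y : invertible_op T -> Ad T X = Ad T Y -> X = Y.
Proof.
move=> [S [_ TS]] XY; apply: inner_bop_inj => x.
have TSx : T (S x) = x by rewrite -[T (S x)]/((T * S) x) TS.
by rewrite -{1 2 3 4}TSx -!inner_Ad XY.
Qed.

Lemma AdZ T c X : Ad T (c *: X) = c *: Ad T X.
Proof.
by apply: inner_bop_inj => x; rewrite inner_Ad !innerZl inner_Ad.
Qed.

Lemma Ad1 X : Ad 1 X = X.
Proof. by apply: inner_bop_inj => x; rewrite inner_Ad. Qed.

(** The quadratic form is real, so [P] and its adjoint have the same one. *)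
Lemma positive_op_adjoint P : positive_op P -> is_adjoint P P.
Proof.
move=> Ppos x y; rewrite -adjointPl; suff <- : P = adjoint P by [].
apply: inner_bop_inj => {x y} x; rewrite adjointPl [RHS]innerC.
exact/esym/conj_Creal/ger0_real/Ppos.
Qed.

End Operators.

Section CompletelyPositiveMaps.
Context {R : realType} {A : cstarAlgType R} {H : hilbertType R}.
Implicit Types (Phi Psi : A -> 'B(H)) (P T : 'B(H)) (a : A).

(** For self-adjoint [h] both [|h| + h] and [|h| - h] are positive, whence [phi h] is both
    nonnegative and nonpositive; real and imaginary parts do the rest. *)
Lemma positive_functional1_eq0 (phi : A -> R[i]) :
  positive_functional phi -> phi 1 = 0 -> forall a, phi a = 0.
Proof.
move=> phip phi1; have phil := phip.1.
have sa0 h : star h = h -> phi h = 0.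
  move=> hsa; have := positive_functional_cpos phip (cpos_alg_sub hsa (lexx _)).
  have hsaN : star (- h) = - h by rewrite starN hsa.
  have := positive_functional_cpos phip (cpos_alg_sub hsaN (lexx _)).
  rewrite !scalarD// !scalarNr// !scalarZr// phi1 !mulr0 !add0r opprK => h0.
  by rewrite oppr_ge0 => h0'; apply/eqP; rewrite eq_le h0 h0'.
move=> a; rewrite (re_im_decomp a) scalarD// (scalarZr 'i (re _) phil).
by rewrite (sa0 _ (star_re _)) (sa0 _ (star_re _)) mulr0 addr0.
Qed.

(** If both values at [1] are nonzero, the normalized functionals are states and [psi] is their
    convex combination with weights [phi1 1 / c] and [phi2 1 / c]. Otherwise one functional is
    zero. *)
Lemma pure_state_dominates (psi phi1 phi2 : A -> R[i]) c :
  pure_state psi -> positive_functional phi1 -> positive_functional phi2 ->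
  (forall a, phi1 a + phi2 a = c * psi a) -> forall a, phi1 a = psi a * phi1 1.
Proof.
move=> [[psil psi0 psi1] psi_ext] phip1 phip2 phiE.
have ge0 phi : positive_functional phi -> 0 <= phi (1 : A).
  by move=> [_ phi0]; have := phi0 1; rewrite star1 mulr1.
have := phiE 1; rewrite psi1 mulr1 => cE.
have [phi10|phi10] := eqVneq (phi1 1) 0.
  by move=> a; rewrite phi10 mulr0 positive_functional1_eq0.
have [phi20|phi20] := eqVneq (phi2 1) 0.
  move=> a; have := phiE a; rewrite -cE phi20 (positive_functional1_eq0 phip2)//.
  by rewrite !addr0 mulrC.
have gt01 : 0 < phi1 1 by rewrite lt_neqAle eq_sym phi10 ge0.
have gt02 : 0 < phi2 1 by rewrite lt_neqAle eq_sym phi20 ge0.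
have c0 : 0 < c by rewrite -cE addr_gt0.
have normalized phi : positive_functional phi -> 0 < phi 1 ->
    states (fun a => (phi 1)^-1 * phi a).
  move=> [phil phi0] phigt0; split.
  - by move=> k x y; rewrite phil mulrDr mulrCA.
  - by move=> a; rewrite mulr_ge0// invr_ge0 ltW.
  - by rewrite mulVf// gt_eqF.
have mulK k u : k != 0 -> k / c * (k^-1 * u) = c^-1 * u.
  by move=> k0; rewrite mulrACA divff// mul1r.
have [||E _] :=
  psi_ext _ _ (phi1 1 / c) (normalized _ phip1 gt01) (normalized _ phip2 gt02).
- by rewrite divr_gt0// ltr_pdivrMr// mul1r -cE ltrDl.
- apply/funext => a.
  rewrite -[RHS]/(phi1 1 / c * ((phi1 1)^-1 * phi1 a) +
                  (1 - phi1 1 / c) * ((phi2 1)^-1 * phi2 a)).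
  have -> : 1 - phi1 1 / c = phi2 1 / c.
    by rewrite -[1](@divff _ c) ?gt_eqF// -mulrBl -cE addrC addKr.
  by rewrite !mulK// -mulrDr phiE mulKf// gt_eqF.
by move=> a; rewrite -E mulrC mulVKf.
Qed.

Lemma sum_opmx n (X : 'M['B(H)]_n) (xi : 'I_n -> H) :
  \sum_i inner (\sum_j X i j (xi j)) (xi i) =
  \sum_i \sum_j inner (X i j (xi j)) (xi i).
Proof. by apply: eq_bigr => i _; rewrite inner_suml. Qed.

Lemma CPD Phi Psi : CP Phi -> CP Psi -> CP (Phi + Psi).
Proof.
move=> [Phil Phip] [Psil Psip]; split.
  move=> c a b; rewrite -[LHS]/(Phi (c *: a + b) + Psi (c *: a + b)).
  by rewrite Phil Psil addrACA -scalerDr.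
move=> n x x0 xi; have := addr_ge0 (Phip n x x0 xi) (Psip n x x0 xi).
rewrite !sum_opmx -big_split /=; congr (0 <= _); apply: eq_bigr => i _.
rewrite -big_split /=; apply: eq_bigr => j _.
by rewrite !mxE -innerDl.
Qed.

Lemma CP0 : CP (0 : A -> 'B(H)).
Proof.
split=> [c a b|n x _ xi]; first by rewrite -[RHS]/(c *: 0 + 0) scaler0 addr0.
rewrite sum_opmx; apply: sumr_ge0 => i _; apply: sumr_ge0 => j _.
by rewrite mxE -[(0 : A -> 'B(H)) _ _]/(0 : H) inner0l.
Qed.

Lemma CP_sum (I : Type) (r : seq I) (Q : pred I) (F : I -> A -> 'B(H)) :
  (forall i, CP (F i)) -> CP (\sum_(i <- r | Q i) F i).
Proof. by move=> F0; elim/big_ind: _ => //; [exact: CP0 | exact: CPD]. Qed.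

Lemma CPZ c Phi : 0 <= c -> CP Phi -> CP (c *: Phi).
Proof.
move=> c0 [Phil Phip]; split.
  move=> k a b; rewrite -[RHS]/(k *: (c *: Phi a) + c *: Phi b) scalerA mulrC.
  by rewrite -scalerA -scalerDr -Phil.
move=> n x x0 xi; have := mulr_ge0 c0 (Phip n x x0 xi).
rewrite !sum_opmx mulr_sumr; congr (0 <= _); apply: eq_bigr => i _.
rewrite mulr_sumr; apply: eq_bigr => j _.
by rewrite !mxE -innerZl.
Qed.

Lemma CP_Ad T Phi : CP Phi -> CP (Ad T \o Phi).
Proof.
move=> [Phil Phip]; split.
  move=> k a b; apply: inner_bop_inj => x.
  rewrite /= Phil inner_Ad innerDl innerZl [RHS]innerDl innerZl !inner_Ad.
  by [].
move=> n x x0 xi; have := Phip n x x0 (T \o xi).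
rewrite !sum_opmx; congr (0 <= _); apply: eq_bigr => i _; apply: eq_bigr => j _.
by rewrite !mxE /= inner_Ad.
Qed.

Lemma CP_positive_functional Phi x :
  CP Phi -> positive_functional (fun a => inner (Phi a x) x).
Proof.
move=> [Phil Phip]; split=> [c a b|a]; first by rewrite Phil innerDl innerZl.
have a0 : positive_mx (const_mx (star a * a) : 'M[A]_1).
  exists (const_mx a); apply/matrixP => i j.
  by rewrite !mxE big_ord1 !mxE.
by have := Phip _ _ a0 (fun=> x); rewrite !big_ord1 !mxE.
Qed.

Lemma CP1_eq0 Phi : CP Phi -> Phi 1 = 0 -> Phi = 0.
Proof.
move=> Phip Phi1; apply/funext => a; apply: inner_bop_eq0 => x.
apply: (positive_functional1_eq0 (CP_positive_functional x Phip)).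
by rewrite Phi1 inner0l.
Qed.

(** At each vector [x] the functionals of [Psi] and of the CP difference add up to
    [<P x, x> psi]. *)
Lemma cp_le_pure_state psi P Psi : pure_state psi -> CP Psi ->
  cp_le Psi (fun a => psi a *: P) -> forall a, Psi a = psi a *: Psi 1.
Proof.
move=> psip Psip PsiP a; apply: inner_bop_inj => x.
rewrite innerZl.
apply: (pure_state_dominates psip (CP_positive_functional x Psip)
  (CP_positive_functional x PsiP)) => b.
rewrite -innerDl -[X in inner X _]/((Psi b + (psi b *: P - Psi b)) x).
by rewrite addrC subrK innerZl mulrC.
Qed.

(** In a convex decomposition the term [t *: Y] is CP-dominated by [Phi] and takes the value
    [t *: P] at [1], so it equals [t *: Phi]; then [t] is cancelled. *)
Lemma extreme_of_dominated Phi P : CP_at P Phi ->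
  (forall Psi t, CP Psi -> cp_le Psi Phi -> Psi 1 = t *: P -> Psi = t *: Phi) ->
  extreme_points (CP_at P) Phi.
Proof.
move=> PhiP dom; split=> // Y Z t [Yp Y1] [Zp Z1] /andP[t0 t1] PhiE.
have dom1 Y' Z' s : CP Y' -> CP Z' -> Y' 1 = P -> 0 < s < 1 ->
    Phi = s *: Y' + (1 - s) *: Z' -> Y' = Phi.
  move=> Yp' Zp' Y1' /andP[s0 s1] PhiE'.
  have : s *: Y' = s *: Phi.
    apply: dom; first by apply: CPZ => //; exact: ltW.
      rewrite /cp_le PhiE' addrAC subrr add0r; apply: CPZ => //.
      by rewrite subr_ge0 ltW.
    by rewrite -Y1'.
  by move/(congr1 (fun F => s^-1 *: F)); rewrite !scalerA mulVf ?gt_eqF// !scale1r.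
split; first by apply: (dom1 Y Z t); rewrite ?t0.
apply: (dom1 Z Y (1 - t)) => //; first by rewrite subr_gt0 t1 ltrBlDr ltrDl.
by rewrite PhiE addrC opprB addrCA subrr addr0.
Qed.

End CompletelyPositiveMaps.

(** * Gram matrices and complete positivity of a positive functional times a positive operator *)

Lemma psd_diagonalization (C : numClosedFieldType) n (G : 'M[C]_n) :
  (forall i j, G i j = Num.conj (G j i)) ->
  (forall v : 'I_n -> C, 0 <= \sum_i \sum_j Num.conj (v i) * G i j * v j) ->
  exists (d : 'I_n -> C) (U : 'M[C]_n), (forall k, 0 <= d k) /\
    forall i j, G i j = \sum_k d k * (Num.conj (U k i) * U k j).
Proof.
move=> Gherm Gpos; set U := spectralmx G.
have Gnormal : G \is normalmx.
  apply: hermitian_normalmx; apply/is_hermitianmxP; rewrite expr0 scale1r.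
  by apply/matrixP => i j; rewrite !mxE.
have Uu : U \is unitarymx by exact: spectral_unitarymx.
have GE := orthomx_spectralP Gnormal; rewrite -/U invmx_unitary// in GE.
set d := spectral_diag G in GE; exists (fun k => d 0 k), U; split.
  move=> k; have /unitarymxP UU := Uu.
  have dE : diag_mx d = U *m G *m map_mx Num.conj U^T.
    by rewrite GE !mulmxA UU mul1mx -mulmxA UU mulmx1.
  (* The conjugate of row [k] of [U] is an eigenvector for [d k], so the form there equals [d k]. *)
  have := Gpos (fun i => Num.conj (U k i)).
  have := congr1 (fun M : 'M_n => M k k) dE; rewrite [LHS]mxE eqxx mulr1n => ->.
  rewrite -mulmxA mxE; congr (0 <= _); apply: eq_bigr => i _.
  rewrite mxE mulr_sumr; apply: eq_bigr => j _.
  by rewrite conjCK !mxE mulrA.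
move=> i j; rewrite [LHS](congr1 (fun M : 'M_n => M i j) GE) mxE.
apply: eq_bigr => k _; rewrite mul_mx_diag !mxE.
by rewrite mulrAC mulrC.
Qed.

Section Main.
Context {R : realType} {A : cstarAlgType R} {H : hilbertType R}.
Implicit Types (Phi Psi : A -> 'B(H)) (P T : 'B(H)) (a : A).

Lemma star_sum (I : Type) (r : seq I) (F : I -> A) :
  star (\sum_(i <- r) F i) = \sum_(i <- r) star (F i).
Proof. by elim/big_rec2: _ => [|i u v _ <-]; rewrite ?star0 ?starD. Qed.

Lemma scalar_sum (phi : A -> R[i]) (I : Type) (r : seq I) (F : I -> A) :
  scalar phi -> phi (\sum_(i <- r) F i) = \sum_(i <- r) phi (F i).
Proof.
by move=> phil; elim/big_rec2: _ => [|i u v _ <-]; rewrite ?scalar0 ?scalarD.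
Qed.

(** Diagonalizing the Gram matrix [<P xi_j, xi_i>] turns the form into a sum of terms
    [d k * psi (star z * z)], with [z] a combination of entries of [y] weighted by row [k] of
    [U]. *)
Lemma CP_scaled_op (psi : A -> R[i]) P :
  positive_functional psi -> positive_op P -> CP (fun a => psi a *: P).
Proof.
move=> [psil psi0] Ppos; split=> [c a b|n _ [y ->] xi].
  by rewrite psil scalerDl scalerA.
pose G : 'M[R[i]]_n := \matrix_(i, j) inner (P (xi j)) (xi i).
have [i j|v|d [U [d0 GE]]] := @psd_diagonalization _ _ G.
- by rewrite !mxE -innerC; exact: positive_op_adjoint.
- have := Ppos (\sum_j v j *: xi j); rewrite inner_sumr; congr (0 <= _).
  apply: eq_bigr => i _; rewrite innerZr.
  have -> : P (\sum_j v j *: xi j) = \sum_j v j *: P (xi j).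
    by elim/big_rec2: _ => [|k u w _ <-]; rewrite ?bop0// bopD bopZ.
  rewrite inner_suml mulr_sumr; apply: eq_bigr => j _.
  by rewrite innerZl mxE mulrA mulrAC.
pose z k l := \sum_j U k j *: y l j.
suff -> : \sum_i inner
      (\sum_j map_mx (fun a => psi a *: P) (starmx y *m y) i j (xi j)) (xi i) =
    \sum_k d k * \sum_l psi (star (z k l) * z k l).
  by apply: sumr_ge0 => k _; rewrite mulr_ge0// sumr_ge0.
rewrite sum_opmx.
transitivity (\sum_i \sum_j \sum_k \sum_l
    d k * (Num.conj (U k i) * U k j * psi (star (y l i) * y l j))).
  apply: eq_bigr => i _; apply: eq_bigr => j _.
  rewrite mxE innerZl; have := GE i j; rewrite mxE => ->.
  rewrite mxE scalar_sum// mulr_sumr; apply: eq_bigr => k _.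
  rewrite mulrC mulr_sumr; apply: eq_bigr => l _.
  by rewrite !mxE; exact/esym/mulrA.
under eq_bigr do rewrite exchange_big /=.
rewrite exchange_big /=; apply: eq_bigr => k _; rewrite mulr_sumr.
under eq_bigr do rewrite exchange_big /=.
rewrite exchange_big /=; apply: eq_bigr => l _.
rewrite /z star_sum mulr_suml scalar_sum// mulr_sumr; apply: eq_bigr => i _.
rewrite mulr_sumr scalar_sum// mulr_sumr; apply: eq_bigr => j _.
have -> : star (U k i *: y l i) * (U k j *: y l j) =
    (Num.conj (U k i) * U k j) *: (star (y l i) * y l j).
  by rewrite starZ -scalerAl -scalerAr scalerA.
by rewrite (scalarZr _ _ psil).
Qed.

Lemma Ad_summand_cp_le n (Phis : 'I_n -> A -> 'B(H)) (T : 'I_n -> 'B(H)) j :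
  (forall i, CP (Phis i)) ->
  cp_le (Ad (T j) \o Phis j) (\sum_i (Ad (T i) \o Phis i)).
Proof.
move=> Phip; rewrite /cp_le (bigD1 j)//= addrAC subrr add0r.
by apply: CP_sum => i; exact: CP_Ad.
Qed.

End Main.

(** * Extremality of the two kinds of pure maps, and non-emptiness *)

Theorem proposition3p13 (R : realType) (A : cstarAlgType R)
    (H : hilbertType R) (P : 'B(H)) (P_pos : positive_op P) :
  ((Cstar_extreme_points P : set (A -> 'B(H))) !=set0 /\
   extreme_points (CP_at P : set (A -> 'B(H))) !=set0) /\
  (forall psi : A -> R[i], pure_state psi ->
     Cstar_extreme_points P (fun a => psi a *: P) /\
     extreme_points (CP_at P) (fun a : A => psi a *: P)) /\
  (forall Phi : A -> 'B(H), pure_CP Phi -> Phi 1 = P ->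
     Cstar_extreme_points P Phi /\ extreme_points (CP_at P) Phi).
Proof.
have pure_stateP (psi : A -> R[i]) : pure_state psi ->
     Cstar_extreme_points P (fun a => psi a *: P) /\
     extreme_points (CP_at P) (fun a : A => psi a *: P).
  move=> psip; have [[psil psi0 psi1] _] := psip.
  have PhiP : CP_at P (fun a => psi a *: P).
    by split; [exact: CP_scaled_op | rewrite psi1 scale1r].
  split; last first.
    apply: extreme_of_dominated => // Psi t Psip PsiP Psi1; apply/funext => a.
    by rewrite (cp_le_pure_state psip Psip PsiP) Psi1 scalerA mulrC -scalerA.
  (* Identity witnesses suffice, since each [Phis j] equals the given map: [cp_le_pure_state] gives
     the equality after conjugation by [T j], which is then cancelled. *)
  split=> // n Phis T n0 PhisP Tinv _ PhiE; exists (fun=> 1) => j.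
  split; first by exists 1; rewrite mulr1.
  have [Phij Phij1] := PhisP j.
  have le_j : cp_le (Ad (T j) \o Phis j) (fun a => psi a *: P).
    by rewrite PhiE; apply: Ad_summand_cp_le => i; have [] := PhisP i.
  apply/funext => a /=; rewrite Ad1; apply: (Ad_inj (Tinv j)).
  have := cp_le_pure_state psip (CP_Ad (T j) Phij) le_j a => /= ->.
  by rewrite Phij1 AdZ.
split; last split=> //.
  have [psi /pure_stateP[PsiC Psie]] := @exists_pure_state R A.
  by split; exists (fun a => psi a *: P).
move=> Phi [Phip pure] Phi1; have PhiP : CP_at P Phi by [].
split; last first.
  apply: extreme_of_dominated => // Psi t Psip PsiP Psi1.
  have [s [_ PsiE]] := pure _ Psip PsiP; rewrite PsiE.
  (* Evaluation at [1] identifies [s] with [t] when [P] is nonzero; when [P = 0] the map [Phi]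
     itself is zero. *)
  have [P0|P0] := eqVneq P 0.
    by rewrite (CP1_eq0 Phip) ?Phi1// !scaler0.
  congr (_ *: _); apply/eqP; rewrite -subr_eq0.
  have : (s - t) *: P = 0.
    by rewrite scalerBl -Psi1 PsiE -{1}Phi1 subrr.
  by move/eqP; rewrite scaler_eq0 (negbTE P0) orbF.
split=> // n Phis T n0 PhisP Tinv _ PhiE.
have summand j : exists S, invertible_op S /\ Phis j = Ad S \o Phi.
  have [Phij Phij1] := PhisP j.
  have le_j : cp_le (Ad (T j) \o Phis j) Phi.
    by rewrite PhiE; apply: Ad_summand_cp_le => i; have [] := PhisP i.
  have [t [/andP[t0 _] tE]] := pure _ (CP_Ad (T j) Phij) le_j.
  have AdE a : Ad (T j) (Phis j a) = t *: Phi a := congr1 (fun F => F a) tE.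
  (* For [t = 0] the map [Phis j] vanishes, so [P = Phis j 1 = 0] and [Phi = 0] too; the identity
     then relates them. *)
  have [t00|tn0] := eqVneq t 0.
    have Phij0 a : Phis j a = 0.
      apply: (Ad_inj (Tinv j)); rewrite AdE t00 scale0r.
      by have := AdZ (T j) 0 0; rewrite !scale0r.
    exists 1; split; first by exists 1; rewrite mulr1.
    apply/funext => a /=; rewrite Ad1 Phij0 (CP1_eq0 Phip)//.
    by rewrite Phi1 -Phij1 Phij0.
  have [r r0 tr] := ge0_rcP t0.
  have rgt0 : 0 < r.
    by rewrite lt_neqAle r0 andbT; apply: contraNneq tn0 => r0'; rewrite tr -r0'.
  have [S [ST TS]] := Tinv j.
  have STx x : S (T j x) = x by rewrite -[S _]/((S * T j) x) ST.
  have TSx x : T j (S x) = x by rewrite -[T j _]/((T j * S) x) TS.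
  (* Solving [Ad (T j) (Phis j a) = t *: Phi a] for [Phis j] gives [t] times conjugation of [Phi] by
     the inverse [S] of [T j]; the factor [t = rc r] is absorbed as a square root. *)
  exists (rc (Num.sqrt r) *: S); split.
    have sqrtK : rc (Num.sqrt r)^-1 * rc (Num.sqrt r) = 1.
      by rewrite -rcM mulVf// gt_eqF// sqrtr_gt0.
    exists (rc (Num.sqrt r)^-1 *: T j); split; apply: eq_bop => x.
      rewrite -[LHS]/(rc (Num.sqrt r)^-1 *: T j (rc (Num.sqrt r) *: S x)).
      by rewrite bopZ scalerA sqrtK scale1r TSx.
    rewrite -[LHS]/(rc (Num.sqrt r) *: S (rc (Num.sqrt r)^-1 *: T j x)).
    by rewrite bopZ scalerA mulrC sqrtK scale1r STx.
  apply/funext => a /=; apply: inner_bop_inj => x; rewrite inner_Ad.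
  rewrite -[RHS]/(inner (Phi a (rc (Num.sqrt r) *: S x)) (rc (Num.sqrt r) *: S x)).
  rewrite bopZ innerZl innerZr conj_rc mulrA -rcM -expr2 sqr_sqrtr// -tr -innerZl.
  by rewrite -[t *: _]/((t *: Phi a) (S x)) -AdE inner_Ad TSx.
have [S SP] := choice summand.
by exists S.
Qed.
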